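(* Let $k\ge 0$ and $L\ge 1$ be integers, let $n_0=n, n_1,\dots,n_L$ be positive integers with $n_L=1$, and let $S(x)=\frac{1}{1+e^{-x}}$ be the sigmoid function. Suppose $\mathcal{V}:[0,1]^n\to[0,1]$ can be expressed as $$\mathcal{V}(x)=S\left(\left(\Phi_{L-1}\circ\Phi_{L-2}\circ\cdots\circ\Phi_1\circ\Phi_0\right)x\right),$$ where each $\Phi_l=\{\phi_{l,i,j}\}$, $0\le l\le L-1$, is an $n_{l+1}\times n_l$ matrix of univariate functions $\phi_{l,i,j}:\mathbb{R}\to\mathbb{R}$ that are $(k+1)$ times continuously differentiable, acting as a Kolmogorov-Arnold layer. Then there exists a constant $C$, depending on $\mathcal{V}$ (and its given representation) but not on the grid size, such that for every grid size $G\in\{1,2,3,\dots\}$ there exist $n_{l+1}\times n_l$ matrices $\Phi_l^G=\{\phi_{l,i,j}^G\}$, $0\le l\le L-1$, whose entries are $k$-th order B-spline functions with grid size $G$, such that the function $$\mathcal{V}(x;\Theta)=S\left(\left(\Phi_{L-1}^{G}\circ\Phi_{L-2}^{G}\circ\cdots\circ\Phi_{0}^{G}\right)x\right)$$ satisfies, for every integer $m$ with $0\le m\le k$, $$\|\mathcal{V}(x)-\mathcal{V}(x;\Theta)\|_{C^m}\le C\,G^{-k-1+m}.$$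
   Context: Kolmogorov-Arnold layer: a matrix $\Phi_l=\{\phi_{l,i,j}\}_{1\le i\le n_{l+1},\,1\le j\le n_l}$ of univariate functions acts on a vector $\mathbf{x}_l=(x_{l,1},\dots,x_{l,n_l})^T$ to give $\mathbf{x}_{l+1}=\Phi_l\circ\mathbf{x}_l\in\mathbb{R}^{n_{l+1}}$ with entries $x_{l+1,i}=\sum_{j=1}^{n_l}\phi_{l,i,j}(x_{l,j})$, $i=1,\dots,n_{l+1}$. The composition $\Phi_{L-1}\circ\cdots\circ\Phi_0$ means successive application of these layers; since $n_L=1$ the result is a real number. $k$-th order B-spline function with grid size $G$: a bounded interval $[a,b]$ (which may depend on the activation function being represented, but not on $G$) is uniformly divided into $G$ subintervals with points $t_0=a<t_1<\dots<t_G=b$, and the knot vector is extended to $t_{-k}<\dots<t_{-1}<t_0<\dots<t_G<t_{G+1}<\dots<t_{G+k}$ (with the same uniform spacing). This gives $G+k$ B-spline basis functions $B_1,\dots,B_{G+k}$, piecewise polynomials of degree $k$, with $B_i$ nonzero only within $[t_{-k+i-1},t_i]$. A $k$-th order B-spline function with grid size $G$ is a linear combination $\sum_{i=1}^{G+k}c_iB_i(x)$ with real coefficients $c_i$. The symbol $\Theta$ denotes the collection of all coefficients of the splines $\phi_{l,i,j}^G$. Norm: for a function $g$ on $[0,1]^n$, $$\|g\|_{C^m}=\max_{|\beta|\le m}\ \sup_{x\in[0,1]^n}|D^\beta g(x)|,$$ where $\beta$ ranges over multi-indices. Since splines of degree $k$ are in general only $C^{k-1}$, for $|\beta|=k$ the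 supremum is taken over the points at which the derivative exists. *)

(* Defs.v *)
From HB Require Import structures.
From mathcomp Require Import all_boot all_order all_algebra.
From mathcomp Require Import all_classical all_reals all_analysis.

Set Implicit Arguments.
Unset Strict Implicit.
Unset Printing Implicit Defensive.

Import Order.TTheory GRing.Theory Num.Theory.
Import numFieldNormedType.Exports.

Local Open Scope classical_set_scope.
Local Open Scope ring_scope.

Definition sigmoid (R : realType) (x : R) : R := 1 / (1 + expR (- x)).

Definition Ck (R : realType) (p : nat) (f : R -> R) : Prop :=
  (forall j : nat, (j < p)%N -> forall x : R, derivable (derive1n j f) x 1) /\
  continuous (derive1n p f).

Definition KAlayer (R : realType) (p q : nat) (phi : 'I_q -> 'I_p -> R -> R)
    (x : 'cV[R]_p) : 'cV[R]_q :=
  \col_i \sum_(j < p) phi i j (x j 0).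

(* [KAnet Phi L x] is (Phi_(L-1) o ... o Phi_0) x; only the layers l < L
   of the sequence [Phi] are used. *)
Fixpoint KAnet (R : realType) (n : nat -> nat)
    (Phi : forall l : nat, 'I_(n l.+1) -> 'I_(n l) -> R -> R)
    (L : nat) (x : 'cV[R]_(n 0%N)) : 'cV[R]_(n L) :=
  match L with
  | 0 => x
  | l.+1 => KAlayer (@Phi l) (KAnet Phi l x)
  end.

Definition knot (R : realType) (a b : R) (G : nat) (i : int) : R :=
  a + i%:~R * ((b - a) / G%:R).

(* Cox-de Boor recursion: the degree-p B-spline supported in
   [t i, t (i + p + 1)].  Degree 0 pieces are half-open on the right. *)
Fixpoint bspline (R : realType) (t : int -> R) (p : nat) (i : int) (x : R) : R :=
  match p with
  | 0 => if (t i <= x) && (x < t (i + 1)) then 1 else 0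
  | p'.+1 =>
      (x - t i) / (t (i + p'.+1%:Z) - t i) * bspline t p' i x +
      (t (i + p'.+2%:Z) - x) / (t (i + p'.+2%:Z) - t (i + 1))
        * bspline t p' (i + 1) x
  end.

(* The ordinal r stands for the 1-based index i = r + 1; the corresponding
   basis function B_i lives on [t_(i-k-1), t_i], so it starts at knot r - k. *)
Definition spline (R : realType) (k G : nat) (a b : R) (c : 'I_(G + k) -> R)
    (x : R) : R :=
  \sum_(r < G + k) c r * bspline (knot a b G) k (r%:Z - k%:Z) x.

Definition cube (R : realType) (n : nat) : set 'cV[R]_n :=
  [set x | forall i, 0 <= x i 0 <= 1].

(* Partial derivatives are taken inside the cube (hence one-sided on its
   faces), so they only depend on the values of f on the cube. *)
Definition pquot (R : realType) (n : nat) (j : 'I_n) (f : 'cV[R]_n -> R)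
    (x : 'cV[R]_n) (h : R) : R :=
  h^-1 * (f (x + h *: delta_mx j 0) - f x).

Definition cubeline (R : realType) (n : nat) (j : 'I_n) (x : 'cV[R]_n)
    : set_system R :=
  within [set h : R | cube (x + h *: delta_mx j 0)] (0 : R)^'.

Definition pderivable (R : realType) (n : nat) (j : 'I_n) (f : 'cV[R]_n -> R)
    (x : 'cV[R]_n) : Prop :=
  cvg (pquot j f x @ cubeline j x).

Definition pderive (R : realType) (n : nat) (j : 'I_n) (f : 'cV[R]_n -> R)
    (x : 'cV[R]_n) : R :=
  lim (pquot j f x @ cubeline j x).

(* Iterated partial derivatives along a list of directions; the head of the
   list is the outermost derivative. *)
Definition iter_pderive (R : realType) (n : nat) (s : seq 'I_n)
    (f : 'cV[R]_n -> R) : 'cV[R]_n -> R :=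
  foldr (fun j g => pderive j g) f s.

(* The iterated derivative exists at x when the inner one exists at all points
   of the cube near x on the line along which the outermost derivative is
   taken (x included), and the outermost difference quotient converges. *)
Fixpoint iter_pderivable (R : realType) (n : nat) (s : seq 'I_n)
    (f : 'cV[R]_n -> R) (x : 'cV[R]_n) : Prop :=
  match s with
  | [::] => True
  | j :: s' =>
      (\forall h \near (0 : R), cube (x + h *: delta_mx j 0) ->
         iter_pderivable s' f (x + h *: delta_mx j 0)) /\
      pderivable j (iter_pderive s' f) x
  end.

Definition midx_order (n : nat) (beta : 'I_n -> nat) : nat :=
  (\sum_(i < n) beta i)%N.

(* D^beta = d_1^(beta_1) ... d_n^(beta_n), in this order. *)
Definition midx_seq (n : nat) (beta : 'I_n -> nat) : seq 'I_n :=
  flatten [seq nseq (beta i) i | i <- enum 'I_n].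

Definition Dmulti (R : realType) (n : nat) (beta : 'I_n -> nat)
    (f : 'cV[R]_n -> R) : 'cV[R]_n -> R :=
  iter_pderive (midx_seq beta) f.

Definition Dexists (R : realType) (n : nat) (beta : 'I_n -> nat)
    (f : 'cV[R]_n -> R) (x : 'cV[R]_n) : Prop :=
  iter_pderivable (midx_seq beta) f x.

Definition Dabs (R : realType) (n : nat) (beta : 'I_n -> nat)
    (f : 'cV[R]_n -> R) (x : 'cV[R]_n) : \bar R :=
  if `[< Dexists beta f x >] then (`|Dmulti beta f x|)%:E else +oo%E.

(* C^m norm on the cube, for functions built from splines of degree k, m <= k.
   For |beta| = k the supremum is restricted to the points where D^beta g
   exists.  For |beta| < k it ranges over the whole cube, and a missing
   derivative makes the norm infinite: a finite bound on the norm entails that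
   all derivatives of order <= m, < k exist everywhere on the cube. *)
Definition Cnorm (R : realType) (n k m : nat) (g : 'cV[R]_n -> R) : \bar R :=
  \big[maxe/0%E]_(beta : {ffun 'I_n -> 'I_m.+1}
                  | (midx_order (fun i => beta i : nat) <= m)%N)
    ereal_sup [set Dabs (fun i => beta i : nat) g x | x in
      [set x | cube x /\ (midx_order (fun i => beta i : nat) = k ->
                          Dexists (fun i => beta i : nat) g x)]].

(* Main.v *)
(* Each activation function is replaced by its de Boor-Fix quasi-interpolant on
   a uniform grid.  By Marsden's identity the dual functionals taken at x
   reproduce the derivatives of f at x exactly, so the error at x is a combination
   of the variations of the functionals between x and a nearby knot.  These
   variations are of order h^(k+1), because the derivative of y |-> mu_i(y)
   telescopes to f^(k+1)(y) times a product of k distances to knots.  Hence the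
   j-th derivative of the error is O(h^(k+1-j)) for j < k and the derivative of
   order k - 1 of the error is Lipschitz with constant O(h).
   For nets H_G of functions on the cube consider the estimates: derivatives of
   F - H_G of order j < p are O(G^(j-p-1)), and those of order p - 1 are Lipschitz
   with constant O(1/G).  They are stable under sums, products and composition,
   hence propagate through the layers, each grid interval being chosen from a
   bound on the outputs of the previous layers.  The Lipschitz constant bounds the
   derivatives of order k wherever they exist, so no analysis of the break points
   of the network is needed. *)
Require Import Defs.
From mathcomp Require Import all_boot all_order all_algebra.
From mathcomp Require Import all_classical all_reals all_analysis.
From mathcomp Require Import ring lra zify.

Set Implicit Arguments.
Unset Strict Implicit.
Unset Printing Implicit Defensive.

Import Order.TTheory GRing.Theory Num.Theory.
Import numFieldNormedType.Exports.
Local Open Scope classical_set_scope.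
Local Open Scope ring_scope.

(** * Derivatives of real functions of one variable *)

Section RealDerivatives.
Variable R : realType.
Implicit Types (f g : R -> R) (x c : R).

Lemma is_derive_val f x d d' : is_derive x 1 f d -> d = d' -> is_derive x 1 f d'.
Proof. by move=> fd <-. Qed.

(** These rules are stated pointwise so that the derivative of an explicit formula is assembled as a
    term and its value adjusted by [is_derive_val]. *)
Lemma is_derive_add f g x df dg : is_derive x 1 f df -> is_derive x 1 g dg ->
  is_derive x 1 (fun y => f y + g y) (df + dg).
Proof. exact: is_deriveD. Qed.

Lemma is_derive_sub f g x df dg : is_derive x 1 f df -> is_derive x 1 g dg ->
  is_derive x 1 (fun y => f y - g y) (df - dg).
Proof. exact: is_deriveB. Qed.

Lemma is_derive_mul f g x df dg : is_derive x 1 f df -> is_derive x 1 g dg ->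
  is_derive x 1 (fun y => f y * g y) (f x * dg + g x * df).
Proof. exact: is_deriveM. Qed.

Lemma is_derive_scale c f x df : is_derive x 1 f df ->
  is_derive x 1 (fun y => c * f y) (c * df).
Proof. exact: is_deriveZ. Qed.

Lemma is_derive_bigsum n (f : 'I_n -> R -> R) x df :
  (forall i, is_derive x 1 (f i) (df i)) ->
  is_derive x 1 (fun y => \sum_(i < n) f i y) (\sum_(i < n) df i).
Proof.
move=> fdf; rewrite (_ : (fun y => _) = \sum_(i < n) f i); first exact: is_derive_sum.
by apply/funext => y; rewrite fct_sumE.
Qed.

Lemma is_derive_shift f x c df : is_derive (x - c) 1 f df ->
  is_derive x 1 (fun y => f (y - c)) df.
Proof.
move=> fdf; have xc : is_derive x 1 (fun y => y - c) (1 - 0).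
  exact: is_derive_sub.
by have := is_derive1_comp (g := fun y => y - c) fdf xc; rewrite subr0 mulr1.
Qed.

(** The difference quotient, completed by [d] at [x], is a Caratheodory slope function: the
    quadratic remainder makes it continuous at [x]. *)
Lemma is_derive_remainder f x C d :
  (forall y, `|f y - f x - (y - x) * d| <= C * (y - x) ^+ 2) -> is_derive x 1 f d.
Proof.
move=> fC; apply/is_derive1_caratheodory.
exists (fun y => if y == x then d else (f y - f x) / (y - x)); split.
- move=> z; case: eqVneq => [->|zx]; first by rewrite !subrr mulr0.
  by rewrite mulfVK// subr_eq0.
- rewrite /prop_for /continuous_at eqxx; apply/cvgrPdist_le => e e0.
  near=> y; case: eqVneq => [_|yx]; first by rewrite subrr normr0 ltW.
  have yx0 : 0 < `|y - x| by rewrite normr_gt0 subr_eq0.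
  rewrite -(ler_pM2r yx0) distrC -normrM mulrBl mulfVK ?subr_eq0// [d * _]mulrC.
  apply: le_trans (fC y) _; rewrite -real_normK ?num_real// expr2 mulrA ler_wpM2r//.
  (* [C] may be zero or negative; |C| + 1 is positive, so [e] can be divided by it. *)
  apply: (@le_trans _ _ ((`|C| + 1) * `|y - x|)).
    by rewrite ler_wpM2r// (le_trans (ler_norm _))// lerDl.
  rewrite mulrC -ler_pdivlMr ?ltr_wpDl// distrC.
  near: y; apply: (@cvgr_dist_le _ _ _ (nbhs x) _ id); first exact: cvg_id.
  by rewrite divr_gt0// ltr_wpDl.
- by rewrite /= eqxx.
Unshelve. all: by end_near. Qed.

End RealDerivatives.

(** * Uniform B-splines and their derivatives *)
Section BSpline.
Variables (R : realType) (a h : R).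
Hypothesis h_gt0 : 0 < h.

Definition unif_knot (i : int) : R := a + i%:~R * h.
Local Notation t := unif_knot.

Lemma unif_knotD i (n : nat) : t (i + n%:Z) = t i + n%:R * h.
Proof. by rewrite /t rmorphD /= -pmulrn mulrDl addrA. Qed.

Lemma unif_knotS i : t (i + 1) = t i + h.
Proof. by rewrite (unif_knotD i 1) mul1r. Qed.

(** With uniform knots both denominators of the recursion equal (p + 1) h. *)
Lemma bsplineS p i x : bspline t p.+1 i x =
  ((x - t i) * bspline t p i x
   + (t i + p.+2%:R * h - x) * bspline t p (i + 1) x) / (p.+1%:R * h).
Proof.
rewrite /= unif_knotS !unif_knotD.
have -> : t i + p.+1%:R * h - t i = p.+1%:R * h by ring.
have -> : t i + p.+2%:R * h - (t i + h) = p.+1%:R * h.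
  by rewrite [in LHS]mulrS; ring.
rewrite [RHS]mulrDl; congr (_ + _); exact: mulrAC.
Qed.

Lemma bspline_left p i x : x < t i -> bspline t p i x = 0.
Proof.
elim: p i => [|p IHp] i xi; first by rewrite /= leNgt xi.
rewrite bsplineS (IHp _ xi) (IHp (i + 1)) ?mulr0 ?addr0 ?mul0r//.
by rewrite unif_knotS ltr_wpDr// ltW.
Qed.

Lemma bspline_right p i x : t i + p.+1%:R * h <= x -> bspline t p i x = 0.
Proof.
elim: p i => [|p IHp] i xi.
  by rewrite /= unif_knotS ltNge -{1}[h]mul1r xi andbF.
have hp := h_gt0; rewrite [p.+2%:R]mulrS in xi.
rewrite bsplineS (IHp i) ?(IHp (i + 1)) ?mulr0 ?addr0 ?mul0r// ?unif_knotS; lra.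
Qed.

(** The pieces of degree 0 are indicators of consecutive half-open cells, hence differences of
    indicators of half-lines, which telescope. *)
Lemma sum_bspline0 i x N : \sum_(r < N) bspline t 0 (i + r%:Z) x
  = (x < t (i + N%:Z))%R%:R - (x < t i)%R%:R.
Proof.
pose s (r : nat) : R := (x < t (i + r%:Z))%R%:R.
rewrite -[in X in _ - (x < t X)%R%:R](addr0 i) -/(s N) -/(s 0) -telescope_sumr//.
rewrite big_mkord; apply: eq_bigr => r _; rewrite /s.
have -> : i + r.+1%:Z = i + r%:Z + 1 by lia.
rewrite /=; have [xl|lx] := ltP x (t (i + r%:Z)) => /=; last first.
  by rewrite subr0; case: ifP.
by rewrite (lt_trans xl) ?unif_knotS ?ltrDl// subrr.
Qed.

(** On the support of the B-spline that it multiplies, each weight of the recursion lies in [0, 1];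
    elsewhere the product vanishes. *)
Lemma ler_norm_bsplineS p i x :
  `|bspline t p.+1 i x| <= `|bspline t p i x| + `|bspline t p (i + 1) x|.
Proof.
have ph : 0 < p.+1%:R * h by rewrite mulr_gt0 ?ltr0n.
rewrite bsplineS normrM normfV (gtr0_norm ph) ler_pdivrMr// [leRHS]mulrDl.
rewrite (le_trans (ler_normD _ _))// lerD// normrM [leLHS]mulrC.
- have [->|B0] := eqVneq (bspline t p i x) 0; first by rewrite normr0 !mul0r.
  rewrite ler_wpM2l//.
  have xl : t i <= x by apply: contra_neqT B0; rewrite -ltNge; exact: bspline_left.
  have xr : x < t i + p.+1%:R * h.
    by apply: contra_neqT B0; rewrite -leNgt; exact: bspline_right.
  by rewrite ger0_norm ?subr_ge0//; lra.
- have [->|B0] := eqVneq (bspline t p (i + 1) x) 0.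
    by rewrite normr0 !mul0r.
  rewrite ler_wpM2l//.
  have xl : t (i + 1) <= x.
    by apply: contra_neqT B0; rewrite -ltNge; exact: bspline_left.
  have xr : x < t (i + 1) + p.+1%:R * h.
    by apply: contra_neqT B0; rewrite -leNgt; exact: bspline_right.
  rewrite unif_knotS in xl xr; rewrite (mulrS 1 p.+1) mulrDl mul1r.
  by rewrite ger0_norm; lra.
Qed.

(** Each recursion step uses a B-spline of lower degree at most twice, so the bound doubles with the
    degree. What matters is that it depends on neither [h] nor [N]. *)
Lemma sum_norm_bspline p i x N :
  \sum_(r < N) `|bspline t p (i + r%:Z) x| <= 2 ^+ p.
Proof.
elim: p i => [|p IHp] i.
  have B0 (r : 'I_N) : `|bspline t 0 (i + r%:Z) x| = bspline t 0 (i + r%:Z) x.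
    by rewrite /=; case: ifP; rewrite ?normr1 ?normr0.
  rewrite (eq_bigr _ (fun r _ => B0 r)).
  by rewrite sum_bspline0 expr0; do 2 case: ltP => ?; rewrite /=; lra.
apply: le_trans; first by apply: ler_sum => r _; exact: ler_norm_bsplineS.
rewrite big_split/= exprS mulrDl mul1r lerD//.
by under eq_bigr => r _ do rewrite addrAC.
Qed.

(* [dbspline j k i] is the j-th derivative of the degree-k B-spline (off the
   knots when j = k). *)
Fixpoint dbspline (j k : nat) (i : int) (x : R) : R :=
  if j is j'.+1 then
    h^-1 * (dbspline j' k.-1 i x - dbspline j' k.-1 (i + 1) x)
  else bspline t k i x.

Lemma dbspline_left j k i x : x < t i -> dbspline j k i x = 0.
Proof.
elim: j k i => [|j IHj] k i xi /=; first exact: bspline_left.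
rewrite (IHj _ _ xi) IHj ?subrr ?mulr0//.
by rewrite unif_knotS ltr_wpDr// ltW.
Qed.

Lemma dbspline_right j k i x :
  (j <= k)%N -> t i + k.+1%:R * h <= x -> dbspline j k i x = 0.
Proof.
elim: j k i => [|j IHj] k i jk xi /=; first exact: bspline_right.
case: k jk xi => // k jk xi; have hp := h_gt0; rewrite [k.+2%:R]mulrS in xi.
by rewrite /= (IHj k i) ?(IHj k (i + 1)) ?subrr ?mulr0// ?unif_knotS; lra.
Qed.

(** Each of the j differences costs a factor 2 / h; the remaining degree k - j contributes 2^(k -
    j). *)
Lemma sum_norm_dbspline j k i x N : (j <= k)%N ->
  \sum_(r < N) `|dbspline j k (i + r%:Z) x| <= 2 ^+ k * h^-1 ^+ j.
Proof.
elim: j k i => [|j IHj] k i jk /=; first by rewrite mulr1 sum_norm_bspline.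
case: k jk => // k jk /=.
under eq_bigr => r _ do rewrite normrM ger0_norm ?invr_ge0 ?(ltW h_gt0)//.
rewrite -mulr_sumr [h^-1 ^+ _]exprS mulrCA ler_wpM2l ?invr_ge0 ?(ltW h_gt0)//.
apply: le_trans; first by apply: ler_sum => r _; exact: ler_normB.
rewrite big_split/= exprS -mulrA mulrDl mul1r lerD//; first exact: IHj.
by under eq_bigr => r _ do rewrite addrAC; exact: IHj.
Qed.

Definition pos_part (y : R) : R := Num.max y 0.

(** Truncated power forms in degrees 1 and 2 start the induction for the derivative formula, since
    the recursion alone does not show the smoothness at the knots. *)
Lemma bspline1E i x : bspline t 1 i x =
  (pos_part (x - t i) - 2 * pos_part (x - t i - h) + pos_part (x - t i - 2 * h)) / h.
Proof.
rewrite bsplineS mul1r /= !unif_knotS; congr (_ / h).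
have hp := h_gt0; set u := t i.
have posE y : 0 <= y -> pos_part y = y by move=> ?; rewrite /pos_part max_l.
have neg0 y : y <= 0 -> pos_part y = 0 by move=> ?; rewrite /pos_part max_r.
have [xu|ux] := ltP x u.
  by rewrite !neg0 ?leNgt ?xu ?(@lt_trans _ _ u x (u + h)) /=; lra.
have [xu1|ux1] := ltP x (u + h).
  by rewrite (posE (x - u)) ?neg0 ?(leNgt (u + h)) ?xu1 /=; lra.
have [xu2|ux2] := ltP x (u + h + h) => /=.
  by rewrite (posE (x - u)) ?(posE (x - u - h)) ?neg0; lra.
by rewrite !posE; lra.
Qed.

Lemma mul_pos_part y : y * pos_part y = pos_part y ^+ 2.
Proof. by rewrite /pos_part /Num.max; case: ltP => _; rewrite ?mulr0 ?expr2 ?mulr0. Qed.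

Lemma bspline2E i x : bspline t 2 i x =
  (pos_part (x - t i) ^+ 2 - 3 * pos_part (x - t i - h) ^+ 2
   + 3 * pos_part (x - t i - 2 * h) ^+ 2 - pos_part (x - t i - 3 * h) ^+ 2)
  / (2 * h ^+ 2).
Proof.
have h0 : h != 0 by rewrite gt_eqF.
rewrite bsplineS !bspline1E unif_knotS -!mul_pos_part.
have -> : x - (t i + h) = x - t i - h by ring.
have -> : x - t i - h - h = x - t i - 2 * h by ring.
have -> : x - t i - h - 2 * h = x - t i - 3 * h by ring.
by field.
Qed.

Lemma is_derive_pos_part_sqr (x : R) :
  is_derive x 1 (fun y : R => pos_part y ^+ 2) (2 * pos_part x).
Proof.
apply: (@is_derive_remainder _ _ _ 1) => y; rewrite /pos_part /Num.max mul1r.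
have := sqr_ge0 (y - x); have := sqr_ge0 x; have := sqr_ge0 y.
rewrite ler_norml; case: (ltP y) => y0; case: (ltP x) => x0;
  (* Across the kink, where [x] and [y] have opposite signs, the remainder estimate also needs x y
     <= 0. *)
  try (have : 0 <= - y * x by apply: mulr_ge0; lra);
  try (have : 0 <= y * - x by apply: mulr_ge0; lra);
  by move=> *; apply/andP; split; lra.
Qed.

(** Induction on the degree from 2, the lowest one for which B-splines are differentiable at the
    knots. *)
Lemma is_derive_bspline p i (x : R) : is_derive x 1 (bspline t p.+2 i)
  (h^-1 * (bspline t p.+1 i x - bspline t p.+1 (i + 1) x)).
Proof.
have h0 : h != 0 by rewrite gt_eqF.
elim: p i => [|p IHp] i.
  rewrite (_ : bspline t 2 i = fun y => (2 * h ^+ 2)^-1 * (pos_part (y - t i) ^+ 2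
    - 3 * pos_part (y - (t i + h)) ^+ 2 + 3 * pos_part (y - (t i + 2 * h)) ^+ 2
    - pos_part (y - (t i + 3 * h)) ^+ 2)); last first.
    apply/funext => y; rewrite bspline2E mulrC.
    by rewrite !opprD !addrA.
  have D c : is_derive x 1 (fun y => pos_part (y - c) ^+ 2) (2 * pos_part (x - c)).
    exact: is_derive_shift (is_derive_pos_part_sqr _).
  apply: (is_derive_val (is_derive_scale _ (is_derive_sub (is_derive_add
    (is_derive_sub (D _) (is_derive_scale 3 (D _))) (is_derive_scale 3 (D _)))
    (D _)))).
  rewrite !bspline1E unif_knotS.
  have -> : x - (t i + h) = x - t i - h by ring.
  have -> : x - t i - h - h = x - t i - 2 * h by ring.
  have -> : x - t i - h - 2 * h = x - t i - 3 * h by ring.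
  have -> : x - (t i + 2 * h) = x - t i - 2 * h by ring.
  have -> : x - (t i + 3 * h) = x - t i - 3 * h by ring.
  by field.
rewrite (_ : bspline t p.+3 i = fun y => (p.+3%:R * h)^-1 *
  ((y - t i) * bspline t p.+2 i y
   + (t i + p.+4%:R * h - y) * bspline t p.+2 (i + 1) y)); last first.
  by apply/funext => y; rewrite bsplineS mulrC.
have B q (j : int) : bspline t q.+1 j x = _ := bsplineS q j x.
have Did : is_derive x 1 (fun y : R => y) 1 by exact: is_derive_id.
have Dc (c : R) : is_derive x 1 (fun=> c) 0 by exact: is_derive_cst.
apply: (is_derive_val (is_derive_scale _ (is_derive_add
  (is_derive_mul (is_derive_sub Did (Dc _)) (IHp i))
  (is_derive_mul (is_derive_sub (Dc _) Did) (IHp (i + 1)))))); cbv beta.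
(* Expanding the undifferentiated factors once more leaves a rational identity in three neighbouring
   B-splines of degree p + 1. *)
rewrite !(B p.+1) !unif_knotS.
have E2 : p.+2%:R = p%:R + 2 :> R by rewrite -addn2 natrD.
have E3 : p.+3%:R = p%:R + 3 :> R by rewrite -addn3 natrD.
have E4 : p.+4%:R = p%:R + 4 :> R by rewrite -addn4 natrD.
have : p%:R + 3 != 0 :> R by rewrite -E3 pnatr_eq0.
have : p%:R + 2 != 0 :> R by rewrite -E2 pnatr_eq0.
rewrite E2 E3 E4; move: (p%:R : R) => q ? ?.
move: (bspline t p.+1 (i + 1 + 1) x) (bspline t p.+1 (i + 1) x) (bspline t p.+1 i x) (t i) => A2 A1 A0 ti.
field.
by apply/and3P; split.
Qed.

(** [dbspline j k] combines B-splines of degree k - j, and the hypothesis makes this degree at least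
    2. *)
Lemma is_derive_dbspline j k i (x : R) : (j.+1 < k)%N ->
  is_derive x 1 (dbspline j k i) (dbspline j.+1 k i x).
Proof.
elim: j k i => [|j IHj] k i jk.
  case: k jk => [|[|k]]; [discriminate|discriminate|move=> _].
  exact: (is_derive_bspline k i x).
have jk' : (j.+1 < k.-1)%N by rewrite ltn_predRL.
exact: (is_derive_scale h^-1 (is_derive_sub (IHj _ i jk') (IHj _ (i + 1) jk'))).
Qed.

(* A hat function is a difference of two clamped ramps; ramps are monotone, so
   the sums of their increments telescope. *)
Lemma sum_norm_bspline1B i x y N :
  \sum_(r < N) `|bspline t 1 (i + r%:Z) x - bspline t 1 (i + r%:Z) y|
    <= 2 / h * `|x - y|.
Proof.
wlog xy : x y / x <= y => [H|].
  have [/H//|/ltW/H] := leP x y; rewrite distrC.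
  by under eq_bigr do rewrite distrC.
(* [P c] is the increment from [x] to [y] of the ramp with corner [c]; it decreases as [c] grows, by
   at most y - x in total. *)
pose P c := pos_part (y - c) - pos_part (x - c).
have P_ge0 c : 0 <= P c by rewrite /P /pos_part /Num.max; do 2 case: ltP => ?; lra.
have P_le c d : c <= d -> 0 <= P c - P d <= y - x.
  by move=> ?; rewrite /P /pos_part /Num.max; do 4 case: ltP => ?; lra.
pose Q (i : int) (r : nat) := - P (t (i + r%:Z)).
have QN j : \sum_(r < N) (Q j r.+1 - Q j r) <= y - x.
  rewrite -(big_mkord xpredT (fun r => Q j r.+1 - Q j r)) telescope_sumr//.
  rewrite /Q addr0 opprK addrC; apply: (andP (P_le _ _ _)).2.
  by rewrite unif_knotD lerDl mulr_ge0// ltW.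
have QS j (r : nat) : Q j r.+1 - Q j r = P (t (j + r%:Z)) - P (t (j + r%:Z) + h).
  rewrite /Q; have -> : j + r.+1%:Z = j + r%:Z + 1 by lia.
  by rewrite unif_knotS opprK addrC.
have le (r : nat) : `|bspline t 1 (i + r%:Z) x - bspline t 1 (i + r%:Z) y| <=
    h^-1 * ((Q i r.+1 - Q i r) + (Q (i + 1) r.+1 - Q (i + 1) r)).
  rewrite !QS !bspline1E -mulrBl normrM mulrC (@ger0_norm _ h^-1) ?invr_ge0 ?(ltW h_gt0)//.
  rewrite ler_wpM2l ?invr_ge0 ?(ltW h_gt0)//.
  have -> : i + 1 + r%:Z = i + r%:Z + 1 by lia.
  rewrite !unif_knotS; set c := t (i + r%:Z).
  have hp := h_gt0.
  have /andP[+ _] : 0 <= P c - P (c + h) <= y - x by apply: P_le; lra.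
  have /andP[+ _] : 0 <= P (c + h) - P (c + h + h) <= y - x by apply: P_le; lra.
  rewrite /P.
  have E1 z : z - (c + h) = z - c - h by ring.
  have E2 z : z - (c + h + h) = z - c - 2 * h by ring.
  rewrite !E1 !E2.
  by move=> ? ?; rewrite ler_norml; apply/andP; split; lra.
apply: le_trans; first by apply: ler_sum => r _; exact: le.
rewrite -mulr_sumr big_split/= [leRHS]mulrAC [leRHS]mulrC ler_wpM2l ?invr_ge0 ?(ltW h_gt0)//.
by rewrite distrC ger0_norm ?subr_ge0// mulr_natl mulr2n lerD.
Qed.

(** The last continuous derivative is a combination of hat functions; the Lipschitz bound for hats
    passes through k differences, each costing 2 / h. *)
Lemma sum_norm_dbsplineB k i x y N :
  \sum_(r < N) `|dbspline k k.+1 (i + r%:Z) x - dbspline k k.+1 (i + r%:Z) y|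
    <= 2 ^+ k.+1 * h^-1 ^+ k.+1 * `|x - y|.
Proof.
elim: k i => [|k IHk] i; first by rewrite !expr1 sum_norm_bspline1B.
have hp : 0 <= h^-1 by rewrite invr_ge0 ltW.
have -> : 2 ^+ k.+2 * h^-1 ^+ k.+2 * `|x - y| =
    h^-1 * (2 ^+ k.+1 * h^-1 ^+ k.+1 * `|x - y| + 2 ^+ k.+1 * h^-1 ^+ k.+1 * `|x - y|).
  by rewrite [2 ^+ k.+2]exprS [h^-1 ^+ k.+2]exprS; ring.
pose d (j : int) := `|dbspline k k.+1 j x - dbspline k k.+1 j y|.
have le (r : 'I_N) : `|dbspline k.+1 k.+2 (i + r%:Z) x - dbspline k.+1 k.+2 (i + r%:Z) y|
    <= h^-1 * (d (i + r%:Z) + d (i + 1 + r%:Z)).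
  rewrite /= -mulrBr normrM ger0_norm// ler_wpM2l// [i + 1 + _]addrAC.
  rewrite opprD opprK addrACA -[- _ + dbspline _ _ (_ + 1) y]opprK.
  by rewrite [- (- _ + _)]opprD opprK; exact: ler_normB.
apply: le_trans; first by apply: ler_sum => r _; exact: le.
by rewrite -mulr_sumr big_split/= ler_wpM2l// lerD// IHk.
Qed.

End BSpline.

(** * Marsden's identity and dual functionals *)
(** Regroups a sum over B-splines of one degree by those of the degree below, each of which occurs
    in two neighbouring terms. In the applications the boundary terms vanish because the point is
    outside the supports. *)
Lemma big_ord_shift (V : zmodType) N (F H : nat -> V) :
  F 0 = 0 -> H N.+1 = 0 ->
  \sum_(r < N.+1) (F r + H r.+1) = \sum_(r < N) (F r.+1 + H r.+1).
Proof.
move=> F0 HN; rewrite !big_split/= big_ord_recl F0 add0r; congr (_ + _).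
by rewrite big_ord_recr/= HN addr0.
Qed.

Lemma derivn_XsubC_exp (R : comNzRingType) (c : R) m n :
  (('X - c%:P) ^+ m)^`(n) = ('X - c%:P) ^+ (m - n) *+ m ^_ n.
Proof.
elim: n => [|n IHn]; first by rewrite derivn0 subn0 ffactn0.
rewrite derivnS IHn derivMn deriv_exp derivXsubC mul1r -mulrnA subnS ffactnSr.
by rewrite mulnC.
Qed.

Section QuasiInterpolant.
Variables (R : realType) (a h : R).
Hypothesis h_gt0 : 0 < h.
Local Notation t := (unif_knot a h).
Local Notation dB := (dbspline a h).

(** The dual polynomial of Marsden's identity: its roots are the k interior knots of the support of
    the i-th B-spline of degree k. *)
Definition knot_poly (k : nat) (i : int) : {poly R} :=
  \prod_(m < k) ('X - (t (i + m.+1%:Z))%:P).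

Lemma knot_polySr k i :
  knot_poly k.+1 i = knot_poly k i * ('X - (t i + k.+1%:R * h)%:P).
Proof. by rewrite /knot_poly big_ord_recr/= unif_knotD. Qed.

Lemma knot_polySl k i :
  knot_poly k.+1 i = knot_poly k (i + 1) * ('X - (t i + h)%:P).
Proof.
rewrite /knot_poly big_ord_recl/= mulrC unif_knotS; congr (_ * _).
apply: eq_bigr => m _; congr ('X - (t _)%:P); rewrite /bump/=; lia.
Qed.

(** Induction on the degree. After regrouping, each B-spline of lower degree is multiplied by a
    weighted mean of two neighbouring knot polynomials; these share all roots but one, and the mean
    is their common factor times X - x. The hypotheses on [x] ensure that every B-spline not
    vanishing at [x] is in the sum. *)
Lemma marsden k i N (x : R) : t i + k%:R * h <= x -> x < t i + N%:R * h ->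
  \sum_(r < N) bspline t k (i + r%:Z) x *: knot_poly k (i + r%:Z)
    = ('X - x%:P) ^+ k.
Proof.
elim: k i N => [|k IHk] i N xl xr.
  rewrite expr0; under eq_bigr do rewrite /knot_poly big_ord0.
  rewrite -scaler_suml.
  rewrite (sum_bspline0 a h_gt0) unif_knotD xr ltNge.
  by move: xl; rewrite mul0r addr0 => ->; rewrite subr0 scale1r.
have kh : 0 < k.+1%:R * h :> R by rewrite mulr_gt0.
case: N xr => [|N] xr; first by exfalso; move: xl xr kh; lra.
pose w (i : int) := (x - t i) / (k.+1%:R * h).
pose F (r : nat) := (w (i + r%:Z) * bspline t k (i + r%:Z) x)
  *: knot_poly k.+1 (i + r%:Z).
pose H (r : nat) := ((1 - w (i + r%:Z)) * bspline t k (i + r%:Z) x)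
  *: knot_poly k.+1 (i + r%:Z - 1).
transitivity (\sum_(r < N.+1) (F r + H r.+1)).
  apply: eq_bigr => r _; rewrite /F /H.
  have -> : i + r.+1%:Z - 1 = i + r%:Z by lia.
  have -> : i + r.+1%:Z = i + r%:Z + 1 by lia.
  rewrite -scalerDl; congr (_ *: _); rewrite bsplineS /w unif_knotS.
  have -> : k.+2%:R * h = h + k.+1%:R * h by rewrite mulrS mulrDl mul1r.
  move: (k.+1%:R * h) (gt_eqF kh) (t _) => c /negbT c0 u.
  by move: (bspline _ _ _ x) (bspline _ _ _ x) => ? ?; field.
rewrite big_ord_shift; first last.
- rewrite /H bspline_left ?mulr0 ?scale0r//.
  by rewrite unif_knotD.
- by rewrite /F addr0 bspline_right ?mulr0 ?scale0r.
rewrite exprSr -(IHk (i + 1) N); first last.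
- by rewrite unif_knotS; move: xr; rewrite mulrS; lra.
- by rewrite unif_knotS; move: xl; rewrite mulrS; lra.
rewrite mulr_suml; apply: eq_bigr => r _; rewrite /F /H.
have -> : i + r.+1%:Z - 1 = i + r%:Z by lia.
have -> : i + r.+1%:Z = i + r%:Z + 1 by lia.
have -> : i + 1 + r%:Z = i + r%:Z + 1 by lia.
set j := i + r%:Z; rewrite -[RHS]scalerAl [knot_poly k.+1 j]knot_polySl knot_polySr.
(* [x] is the mean, with the recursion weight, of the two roots in which the neighbouring
   polynomials differ. *)
rewrite unif_knotS; have : x = t j + h + w (j + 1) * (k.+1%:R * h).
  by rewrite /w mulfVK ?gt_eqF// unif_knotS addrC subrK.
move: (bspline _ _ _ x) (w (j + 1)) => b u ->.
rewrite [u * _]mulrC [(1 - _) * _]mulrC -!scalerA -scalerDr; congr (_ *: _).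
rewrite !scalerAr -mulrDr; congr (_ * _).
by rewrite -!mul_polyC polyCB polyC1 !polyCD polyCM; ring.
Qed.

(** Marsden's identity differentiated j times in x. The derivation is algebraic, from the
    differences defining [dbspline], so that it also covers the knots when j = k: neighbouring
    polynomials differ by a common factor times (k + 1) h, and h cancels. *)
Lemma marsden_dbspline j k i N (x : R) : (j <= k)%N ->
    t i + k%:R * h <= x -> x < t i + N%:R * h ->
  \sum_(r < N) dB j k (i + r%:Z) x *: knot_poly k (i + r%:Z)
    = ((-1) ^+ j * (k ^_ j)%:R) *: ('X - x%:P) ^+ (k - j).
Proof.
elim: j k i N => [|j IHj] k i N jk xl xr.
  by rewrite mul1r ffactn0 scale1r subn0 -(@marsden k i N x).
case: k jk xl => // k jk xl.
have kh : 0 < k.+1%:R * h :> R by rewrite mulr_gt0.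
case: N xr => [|N] xr; first by exfalso; move: xl xr kh; lra.
pose F (r : nat) := (h^-1 * dB j k (i + r%:Z) x) *: knot_poly k.+1 (i + r%:Z).
pose H (r : nat) := - ((h^-1 * dB j k (i + r%:Z) x)
  *: knot_poly k.+1 (i + r%:Z - 1)).
transitivity (\sum_(r < N.+1) (F r + H r.+1)).
  apply: eq_bigr => r _; rewrite /F /H.
  have -> : i + r.+1%:Z - 1 = i + r%:Z by lia.
  have -> : i + r.+1%:Z = i + r%:Z + 1 by lia.
  by rewrite -scalerBl /= mulrBr.
rewrite big_ord_shift; first last.
- by rewrite /H dbspline_left ?mulr0 ?scale0r ?oppr0// unif_knotD.
- by rewrite /F addr0 dbspline_right ?mulr0 ?scale0r.
have -> : (-1) ^+ j.+1 * (k.+1 ^_ j.+1)%:R = - k.+1%:R * ((-1) ^+ j * (k ^_ j)%:R) :> R.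
  by rewrite exprS ffactnS natrM; ring.
rewrite subSS -scalerA -(IHj k (i + 1) N jk); first last.
- by rewrite unif_knotS; move: xr; rewrite mulrS; lra.
- by rewrite unif_knotS; move: xl; rewrite mulrS; lra.
rewrite scaler_sumr; apply: eq_bigr => r _; rewrite /F /H.
have -> : i + r.+1%:Z - 1 = i + r%:Z by lia.
have -> : i + r.+1%:Z = i + r%:Z + 1 by lia.
have -> : i + 1 + r%:Z = i + r%:Z + 1 by lia.
set l := i + r%:Z; rewrite -scalerBr [knot_poly k.+1 l]knot_polySl knot_polySr.
rewrite -mulrBr unif_knotS.
have -> : 'X - (t l + h + k.+1%:R * h)%:P - ('X - (t l + h)%:P)
    = (- (k.+1%:R * h))%:P by rewrite !polyCN !polyCD; ring.
rewrite [knot_poly _ _ * _]mulrC mul_polyC !scalerA; congr (_ *: _).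
by move: (dB _ _ _ _) (k.+1%:R) (gt_eqF h_gt0) => b c /negbT h0; field.
Qed.

Variable f : R -> R.

(* The de Boor-Fix dual functional of the i-th B-spline, taken at the point y. *)
Definition dual_coef (k : nat) (i : int) (y : R) : R :=
  (k`!%:R)^-1 * \sum_(v < k.+1)
     (-1) ^+ v * (derive1n v f y * (knot_poly k i)^`(k - v).[y]).

(** Differentiate the identity k - v times in X and set X = x: a power of X - x survives only for v
    = j, where it gives k! up to the sign that the functional compensates. *)
Lemma sum_dual_coef j k i N (x : R) : (j <= k)%N ->
    t i + k%:R * h <= x -> x < t i + N%:R * h ->
  \sum_(r < N) dual_coef k (i + r%:Z) x * dB j k (i + r%:Z) x = derive1n j f x.
Proof.
move=> jk xl xr; have kf : k`!%:R != 0 :> R by rewrite pnatr_eq0 -lt0n fact_gt0.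
under eq_bigr do rewrite /dual_coef -mulrA mulr_suml.
rewrite -mulr_sumr exchange_big/=.
have E v : (v <= k)%N ->
    \sum_(r < N) dB j k (i + r%:Z) x * (knot_poly k (i + r%:Z))^`(k - v).[x]
    = (-1) ^+ j * (v == j)%:R * k`!%:R.
  move=> vk.
  transitivity ((\sum_(r < N) dB j k (i + r%:Z) x *: knot_poly k (i + r%:Z))^`(k - v).[x]).
    rewrite (raddf_sum (derivn (k - v)))/= horner_sum.
    by apply: eq_bigr => r _; rewrite derivnZ hornerZ.
  rewrite marsden_dbspline// derivnZ hornerZ derivn_XsubC_exp hornerMn horner_exp.
  rewrite hornerXsubC subrr expr0n -!mulrA; congr (_ * _).
  have [->|vj] := eqVneq v j.
    by rewrite subnn !eqxx mul1r -natrM ffactnn ffact_fact.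
  rewrite mul0r; have [kv|kv] := ltnP (k - j) (k - v).
    by rewrite (ffact_small kv) mulr0n mulr0.
  by rewrite subn_eq0 leqNgt (_ : (_ < _)%N)/= ?mul0rn ?mulr0//; lia.
have -> : derive1n j f x = (k`!%:R)^-1 * \sum_(v < k.+1)
    (-1) ^+ v * derive1n v f x * ((-1) ^+ j * (v == j :> nat)%:R * k`!%:R).
  rewrite (bigD1 (inord j : 'I_k.+1))//= inordK ?ltnS// eqxx big1 ?addr0.
    move: (derive1n j f x) (k`!%:R) kf => D c c0.
    have -> : (-1) ^+ j * D * ((-1) ^+ j * 1 * c) = (-1) ^+ j ^+ 2 * (c * D).
      by ring.
    by rewrite sqrr_sign mul1r mulKf.
  move=> v vj; rewrite (_ : (v == j :> nat) = false) ?mulr0 ?mul0r ?mulr0//.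
  by apply: contra_neqF vj => /eqP vj; apply/val_inj; rewrite /= inordK ?ltnS.
congr (_ * _); apply: eq_bigr => v _; rewrite -E ?mulr_sumr; last by rewrite -ltnS.
by apply: eq_bigr => r _; ring.
Qed.

Lemma is_derive_dual_coef k i (y : R) :
    (forall j, (j <= k)%N -> is_derive y 1 (derive1n j f) (derive1n j.+1 f y)) ->
  is_derive y 1 (dual_coef k i)
    ((k`!%:R)^-1 * ((-1) ^+ k * (derive1n k.+1 f y * (knot_poly k i).[y]))).
Proof.
move=> df; set p := knot_poly k i.
(* By the product rule the v-th summand has derivative [u v - u v.+1]. The end term [u 0] contains
   the derivative of order k + 1 of a polynomial of degree k, so only [u k.+1] survives. *)
pose u v := (-1) ^+ v * (derive1n v f y * p^`(k.+1 - v).[y]).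
have D (v : 'I_k.+1) : is_derive y 1
    (fun y => (-1) ^+ v * (derive1n v f y * p^`(k - v).[y])) (u v - u v.+1).
  have vk : (v <= k)%N by rewrite -ltnS.
  apply: (is_derive_val (is_derive_scale _ (is_derive_mul (df v vk)
    (is_derive_poly _ _)))).
  by rewrite /u subSS subSn// derivnS exprS; ring.
apply: (is_derive_val (is_derive_scale _ (is_derive_bigsum D))).
congr (_ * _).
have -> : \sum_(v < k.+1) (u v - u v.+1) = - (u k.+1 - u 0).
  rewrite -telescope_sumr// -sumrN big_mkord.
  by apply: eq_bigr => v _; rewrite opprB.
rewrite /u subnn subn0 derivn0 derivn_poly0 ?horner0 ?mulr0 ?subr0; last first.
  by rewrite /p /knot_poly size_prod_XsubC /index_enum -enumT size_enum_ord.
by rewrite exprS mulN1r mulNr opprK.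
Qed.

End QuasiInterpolant.

(** * Error of the quasi-interpolant *)
Section MeanValue.
Variable R : realType.
Implicit Types f g df : R -> R.

Lemma lipschitz_derive f df (x y K : R) :
    (forall z, Num.min x y <= z <= Num.max x y -> is_derive z 1 f (df z)) ->
    (forall z, Num.min x y <= z <= Num.max x y -> `|df z| <= K) ->
  `|f x - f y| <= K * `|x - y|.
Proof.
wlog xy : x y / x <= y => [H fdf dfK|].
  have [/H|/ltW/H] := leP x y; first exact.
  by rewrite minC maxC distrC [`|y - x|]distrC; exact.
rewrite min_l// max_r// => fdf dfK.
have [||z] := @MVT_segment _ f df x y xy.
- by move=> z; rewrite in_itv/= => /andP[? ?]; apply: fdf; rewrite !ltW.
- by apply: derivable_within_continuous => z; rewrite in_itv/= => /fdf[].
rewrite in_itv/= => /dfK zK; rewrite distrC => ->.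
by rewrite normrM [`|x - y|]distrC ler_wpM2r.
Qed.

Lemma continuous_bounded_itv f (p q : R) : continuous f ->
  exists2 M, 0 <= M & forall x, p <= x <= q -> `|f x| <= M.
Proof.
move=> cf; have [pq|qp] := leP p q; last first.
  by exists 0 => // x /andP[px xq]; move: (le_trans px xq); rewrite leNgt qp.
have [|c _ cM] := @EVT_max _ (fun x => `|f x|) p q pq.
  apply: continuous_subspaceT => x.
  by apply: (@continuous_comp _ _ _ f Num.norm); [exact: cf|exact: norm_continuous].
by exists `|f c| => // x xpq; apply: cM; rewrite in_itv.
Qed.

(* By repeated bisection of [x, y]. *)
Lemma lipschitz_local_global f (p q d K : R) : 0 < d ->
    (forall x y, p <= x < q -> p <= y < q -> `|x - y| <= d ->
       `|f x - f y| <= K * `|x - y|) ->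
  forall x y, p <= x < q -> p <= y < q -> `|f x - f y| <= K * `|x - y|.
Proof.
move=> d0 fK x y xpq ypq.
have [n xyn] : exists n : nat, `|x - y| <= 2 ^+ n * d.
  exists (Num.bound (`|x - y| / d)); rewrite -ler_pdivrMr//.
  have /archi_boundP/ltW/le_trans : 0 <= `|x - y| / d by rewrite divr_ge0// ltW.
  apply.
  by rewrite -natrX ler_nat ltnW// ltn_expl.
elim: n x y xyn xpq ypq => [|n IHn] x y; first by rewrite mul1r => *; exact: fK.
rewrite exprS -mulrA => xyn xpq ypq; pose z := (x + y) / 2.
have zpq : p <= z < q.
  by move: xpq ypq => /andP[? ?] /andP[? ?]; rewrite /z; apply/andP; split; lra.
have xz : `|x - z| = `|x - y| / 2.
  by rewrite -[in RHS](@ger0_norm _ 2)// -normfV -normrM; congr `|_|; rewrite /z; field.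
have zy : `|z - y| = `|x - y| / 2.
  by rewrite -[in RHS](@ger0_norm _ 2)// -normfV -normrM; congr `|_|; rewrite /z; field.
have := IHn x z; rewrite xz ler_pdivrMr// mulrC => /(_ xyn xpq zpq) A.
have := IHn z y; rewrite zy ler_pdivrMr// mulrC => /(_ xyn zpq ypq) B.
have := ler_distD (f z) (f x) (f y); move: A B.
by lra.
Qed.

Lemma Ck_is_derive k f j (x : R) : Ck k f -> (j < k)%N ->
  is_derive x 1 (derive1n j f) (derive1n j.+1 f x).
Proof.
move=> [df _] jk; rewrite derive1nS derive1E.
by apply: DeriveDef => //; exact: df.
Qed.

End MeanValue.

Section InterpolationError.
Variables (R : realType) (a h : R) (k : nat) (f : R -> R) (i0 : int) (N : nat) (M : R).
Hypotheses (h_gt0 : 0 < h) (fC : Ck k.+1 f).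
Local Notation t := (unif_knot a h).
Local Notation dB := (dbspline a h).
Local Notation mu := (dual_coef a h f k).
Hypothesis fM : forall x, t i0 <= x <= t i0 + N%:R * h ->
  `|derive1n k.+1 f x| <= M.

Let M_ge0 : 0 <= M.
Proof.
apply: le_trans (normr_ge0 _) (fM (x := t i0) _).
by rewrite lexx lerDl mulr_ge0// ltW.
Qed.

(* The factor k + 2 leaves room for points at distance h from the support. *)
Lemma knot_poly_bound i z : t i - h <= z <= t i + k.+2%:R * h ->
  `|(knot_poly a h k i).[z]| <= (k.+2%:R * h) ^+ k.
Proof.
move=> /andP[zl zr]; rewrite horner_prod normr_prod.
apply: (@le_trans _ _ (\prod_(m < k) (k.+2%:R * h))); last first.
  by rewrite prodr_const card_ord.
apply: ler_prod => m _; rewrite normr_ge0/= hornerXsubC unif_knotD.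
have m1 : 0 <= m.+1%:R * h by rewrite mulr_ge0// ltW.
have mk : m.+1%:R * h <= k%:R * h by rewrite ler_pM2r// ler_nat.
have hp := h_gt0; rewrite ler_norml; apply/andP; split; last by lra.
by rewrite -[k.+2]addn2 natrD mulrDl; lra.
Qed.

Let near_supp i (x : R) := t i - h <= x <= t i + k.+2%:R * h.

(** Mean value inequality for the telescoped derivative; the factor 1 / k! is discarded. *)
Lemma dual_coef_lipschitz i x y :
    t i0 <= x <= t i0 + N%:R * h -> t i0 <= y <= t i0 + N%:R * h ->
    near_supp i x -> near_supp i y ->
  `|mu i x - mu i y| <= M * (k.+2%:R * h) ^+ k * `|x - y|.
Proof.
move=> xJ yJ xi yi; apply: lipschitz_derive => z zxy.
  by apply: is_derive_dual_coef => j jk; exact: Ck_is_derive fC _.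
have between l u : l <= x <= u -> l <= y <= u -> l <= z <= u.
  move=> /andP[lx xu] /andP[ly yu]; case/andP: zxy => zl zr; apply/andP; split.
    by apply: le_trans zl; rewrite le_min lx ly.
  by apply: le_trans zr _; rewrite ge_max xu yu.
rewrite normrM normfV (@ger0_norm _ k`!%:R)// normrM normrX normrN1 expr1n mul1r.
rewrite ler_pdivrMl ?ltr0n ?fact_gt0//.
apply: (@le_trans _ _ (M * (k.+2%:R * h) ^+ k)); last first.
  by rewrite ler_peMl ?ler1n ?fact_gt0// mulr_ge0// exprn_ge0// mulr_ge0// ltW.
by rewrite normrM ler_pM// ?fM ?knot_poly_bound//; apply: between.
Qed.

Let c (r : nat) := mu (i0 + r%:Z) (t (i0 + r%:Z)).
Let err j x := derive1n j f x - \sum_(r < N) c r * dB j k (i0 + r%:Z) x.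
(** [D] and [E] delimit the range where Marsden's identity holds for these [N] B-splines; for the
    spline on [a, b] they become [a] and [b]. *)
Let D := t i0 + k%:R * h.
Let E := t i0 + N%:R * h.

Let D_ge : t i0 <= D. Proof. by rewrite lerDl mulr_ge0// ltW. Qed.

Let knot_in (r : 'I_N) : t i0 <= t (i0 + r%:Z) <= t i0 + N%:R * h.
Proof.
by rewrite unif_knotD lerDl mulr_ge0 ?(ltW h_gt0)//= lerD2l ler_pM2r// ler_nat ltnW.
Qed.

Let knot_near i : near_supp i (t i).
Proof.
rewrite /near_supp; have : 0 <= k.+2%:R * h by rewrite mulr_ge0// ltW.
by move: h_gt0 => *; apply/andP; split; lra.
Qed.

Lemma dbspline_supp j i x : (j <= k)%N -> dB j k i x != 0 ->
  t i <= x <= t i + k.+1%:R * h.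
Proof.
move=> jk B0; apply/andP; split.
  by apply: contra_neqT B0; rewrite -ltNge => /dbspline_left ->.
by apply: contra_neqT B0; rewrite -ltNge => /ltW/dbspline_right ->.
Qed.

Lemma interpolation_error j x : (j <= k)%N -> D <= x < E ->
  `|err j x| <= M * (k.+2%:R * h) ^+ k.+1 * (2 ^+ k * h^-1 ^+ j).
Proof.
move=> jk /andP[xD xE]; have xJ : t i0 <= x <= t i0 + N%:R * h.
  by rewrite (le_trans D_ge xD) ltW.
have hk n : 0 <= n%:R * h by rewrite mulr_ge0// ltW.
(* Exact reproduction at [x] turns the error into a sum of variations of functionals between [x] and
   the left end of a support containing [x]. *)
rewrite /err -(sum_dual_coef h_gt0 f jk xD xE) -sumrB.
apply: le_trans (ler_norm_sum _ _ _) _.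
apply: (@le_trans _ _ (\sum_(r < N)
    M * (k.+2%:R * h) ^+ k.+1 * `|dB j k (i0 + r%:Z) x|)); last first.
  by rewrite -mulr_sumr ler_wpM2l ?sum_norm_dbspline// mulr_ge0// exprn_ge0.
apply: ler_sum => r _; rewrite -mulrBl normrM.
have [->|B0] := eqVneq (dB j k (i0 + r%:Z) x) 0; first by rewrite normr0 !mulr0.
rewrite ler_wpM2r// exprSr mulrA.
have /andP[xl xr] := dbspline_supp jk B0.
have kS : k.+2%:R * h = k.+1%:R * h + h by rewrite -natr1 mulrDl mul1r.
have hp := h_gt0.
apply: le_trans (dual_coef_lipschitz xJ (knot_in r) _ (knot_near _)) _.
  by rewrite /near_supp; apply/andP; split; lra.
rewrite ler_wpM2l ?mulr_ge0 ?exprn_ge0//.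
by rewrite ger0_norm ?subr_ge0//; lra.
Qed.

Lemma interpolation_error_lipschitz j x y : k = j.+1 ->
    D <= x < E -> D <= y < E ->
  `|err j x - err j y| <= (M * (k.+2%:R * h) ^+ k * (2 ^+ k * h^-1 ^+ j)
    + M * (k.+2%:R * h) ^+ k.+1 * (2 ^+ k * h^-1 ^+ k)) * `|x - y|.
Proof.
move=> kj; have jk : (j <= k)%N by rewrite kj.
(* It suffices to compare points at distance at most [h]. *)
move: x y; apply: lipschitz_local_global h_gt0 _ => x y.
move=> /andP[xD xE] /andP[yD yE] xyh.
have xJ : t i0 <= x <= t i0 + N%:R * h by rewrite (le_trans D_ge xD) ltW.
have yJ : t i0 <= y <= t i0 + N%:R * h by rewrite (le_trans D_ge yD) ltW.
have hk n : 0 <= n%:R * h by rewrite mulr_ge0// ltW.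
have kS : k.+2%:R * h = k.+1%:R * h + h by rewrite -natr1 mulrDl mul1r.
have hp := h_gt0; have := xyh; rewrite ler_norml => /andP[xyl xyr].
rewrite /err -(sum_dual_coef h_gt0 f jk xD xE) -(sum_dual_coef h_gt0 f jk yD yE).
rewrite -!sumrB.
(* [A] moves the functional from [x] to [y]; [B] moves the B-spline derivative, which is Lipschitz
   as k = j + 1. *)
pose A (r : 'I_N) := (mu (i0 + r%:Z) x - mu (i0 + r%:Z) y) * dB j k (i0 + r%:Z) x.
pose B (r : 'I_N) := (mu (i0 + r%:Z) y - c r)
  * (dB j k (i0 + r%:Z) x - dB j k (i0 + r%:Z) y).
rewrite (_ : \sum_(r < N) _ = \sum_(r < N) A r + \sum_(r < N) B r); last first.
  by rewrite -big_split; apply: eq_bigr => r _; rewrite /A /B /=; ring.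
rewrite mulrDl (le_trans (ler_normD _ _))// lerD//.
- apply: le_trans (ler_norm_sum _ _ _) _.
  apply: (@le_trans _ _ (\sum_(r < N)
      M * (k.+2%:R * h) ^+ k * `|x - y| * `|dB j k (i0 + r%:Z) x|)); last first.
    rewrite -mulr_sumr [leRHS]mulrAC ler_wpM2l ?sum_norm_dbspline//.
    by rewrite !mulr_ge0// exprn_ge0.
  apply: ler_sum => r _; rewrite /A normrM.
  have [->|B0] := eqVneq (dB j k (i0 + r%:Z) x) 0; first by rewrite normr0 !mulr0.
  have /andP[xl xr] := dbspline_supp jk B0.
  rewrite ler_wpM2r// dual_coef_lipschitz// /near_supp; apply/andP; split; lra.
- apply: le_trans (ler_norm_sum _ _ _) _.
  apply: (@le_trans _ _ (\sum_(r < N) M * (k.+2%:R * h) ^+ k.+1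
      * `|dB j k (i0 + r%:Z) x - dB j k (i0 + r%:Z) y|)); last first.
    rewrite -mulr_sumr -[leRHS]mulrA ler_wpM2l ?mulr_ge0 ?exprn_ge0//.
    by have := sum_norm_dbsplineB a h_gt0 j i0 x y N; rewrite -kj.
  apply: ler_sum => r _; rewrite /B normrM.
  have near_y : t (i0 + r%:Z) - h <= y <= t (i0 + r%:Z) + k.+2%:R * h ->
      `|mu (i0 + r%:Z) y - c r| <= M * (k.+2%:R * h) ^+ k.+1.
    move=> yr; apply: le_trans (dual_coef_lipschitz yJ (knot_in r) yr (knot_near _)) _.
    rewrite exprSr mulrA ler_wpM2l ?mulr_ge0 ?exprn_ge0//.
    case/andP: yr => ? ?; rewrite ler_norml; apply/andP; split; last by lra.
    by rewrite -[k.+2]addn2 natrD mulrDl; have := hk k; lra.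
  (* A nonzero term has [x] or [y] in the support, so [y] is within [h] of it: this is the margin in
     [near_supp]. *)
  have [Bx|Bx] := eqVneq (dB j k (i0 + r%:Z) x) 0; last first.
    have /andP[xl xr] := dbspline_supp jk Bx.
    by rewrite ler_wpM2r// near_y//; apply/andP; split; lra.
  have [By|By] := eqVneq (dB j k (i0 + r%:Z) y) 0.
    by rewrite Bx By subrr normr0 !mulr0.
  have /andP[xl xr] := dbspline_supp jk By.
  by rewrite ler_wpM2r// near_y//; apply/andP; split; lra.
Qed.

End InterpolationError.

Definition interp_coef (R : realType) (k G : nat) (a b : R) (f : R -> R)
    (r : 'I_(G + k)) : R :=
  let h := (b - a) / G%:R in
  dual_coef a h f k (r%:Z - k%:Z) (unif_knot a h (r%:Z - k%:Z)).

(* The j-th derivative of the quasi-interpolating spline, off the knots if j = k. *)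
Definition dinterp (R : realType) (k G : nat) (a b : R) (f : R -> R) (j : nat)
    (x : R) : R :=
  \sum_(r < G + k) @interp_coef R k G a b f r
     * dbspline a ((b - a) / G%:R) j k (r%:Z - k%:Z) x.

Lemma is_derive_dinterp (R : realType) (k G : nat) (a b : R) (f : R -> R) j (x : R) :
    a < b -> (0 < G)%N -> (j.+1 < k)%N ->
  is_derive x 1 (dinterp k G a b f j) (dinterp k G a b f j.+1 x).
Proof.
move=> ab G0 jk; apply: is_derive_bigsum => r; apply: is_derive_scale.
by apply: is_derive_dbspline => //; rewrite divr_gt0 ?subr_gt0 ?ltr0n.
Qed.

Lemma dinterp_error (R : realType) (k : nat) (a b : R) (f : R -> R) :
  a < b -> Ck k.+1 f -> exists2 K, 0 <= K & forall G, (0 < G)%N ->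
    (forall j x, (j <= k)%N -> a <= x < b ->
       `|derive1n j f x - dinterp k G a b f j x| <= K * G%:R^-1 ^+ (k.+1 - j)) /\
    (forall j x y, k = j.+1 -> a <= x < b -> a <= y < b ->
       `|derive1n j f x - dinterp k G a b f j x
         - (derive1n j f y - dinterp k G a b f j y)| <= K * G%:R^-1 * `|x - y|).
Proof.
move=> ab fC; have cf : continuous (derive1n k.+1 f) := fC.2.
(* The knots start at a - k h and h <= b - a, so this interval serves all grid sizes. *)
have [M M0 fM] := continuous_bounded_itv (a - k%:R * (b - a)) b cf.
have ba : 0 < b - a by rewrite subr_gt0.
(* [L] dominates 1 and b - a, so L^(k + 1) bounds (b - a)^(k + 1 - j) for every j. *)
pose L := 1 + (b - a); have L1 : 1 <= L by rewrite lerDl ltW.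
have L0 : 0 <= L by rewrite (le_trans _ L1).
(* The factor 2 serves the two terms of the Lipschitz estimate. *)
exists (2 * (M * k.+2%:R ^+ k.+1 * 2 ^+ k * L ^+ k.+1)).
  by rewrite !mulr_ge0// exprn_ge0.
move=> G G0; set g := G%:R^-1; set K := M * _ * _ * _.
have g0 : 0 < g by rewrite invr_gt0 ltr0n.
have K0 : 0 <= K by rewrite !mulr_ge0// exprn_ge0.
pose h := (b - a) / G%:R; have h0 : 0 < h by rewrite mulr_gt0.
have Gh : G%:R * h = b - a by rewrite mulrC divfK// gt_eqF// ltr0n.
have hba : h <= b - a by rewrite ler_pdivrMr ?ltr0n// ler_peMr ?(ltW ba)// ler1n.
pose i0 : int := - k%:Z.
have ti0 : unif_knot a h i0 = a - k%:R * h.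
  by rewrite /unif_knot rmorphN /= -pmulrn mulNr.
have tD : unif_knot a h i0 + k%:R * h = a by rewrite ti0 subrK.
have tE : unif_knot a h i0 + (G + k)%:R * h = b.
  by rewrite ti0 natrD mulrDl Gh; ring.
have fM' x : unif_knot a h i0 <= x <= unif_knot a h i0 + (G + k)%:R * h ->
    `|derive1n k.+1 f x| <= M.
  rewrite tE ti0 => /andP[xl xr]; apply: fM; rewrite xr andbT.
  by apply: le_trans xl; rewrite lerD2l lerN2 ler_wpM2l.
have dE j x : dinterp k G a b f j x = \sum_(r < G + k)
    dual_coef a h f k (i0 + r%:Z) (unif_knot a h (i0 + r%:Z)) * dbspline a h j k (i0 + r%:Z) x.
  by apply: eq_bigr => r _; rewrite /interp_coef -/h [_ - k%:Z]addrC.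
have hg j : (j <= k)%N ->
   M * (k.+2%:R * h) ^+ k.+1 * (2 ^+ k * h^-1 ^+ j) <= K * g ^+ (k.+1 - j).
  move=> jk; have -> : h^-1 ^+ j = h ^- j by rewrite exprVn.
  have -> : M * (k.+2%:R * h) ^+ k.+1 * (2 ^+ k * h ^- j) =
      M * k.+2%:R ^+ k.+1 * 2 ^+ k * (h ^+ (k.+1 - j)).
    rewrite exprMn -[in LHS](subnK (leqW jk)) [h ^+ (_ + _)]exprD subnK ?leqW//.
    by have := lt0r_neq0 (exprn_gt0 j h0) => ?; field.
  rewrite /K -[leRHS]mulrA ler_wpM2l ?mulr_ge0 ?exprn_ge0//.
  rewrite /h exprMn ler_wpM2r ?exprn_ge0 ?(ltW g0)//.
  apply: (@le_trans _ _ (L ^+ (k.+1 - j))).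
    by rewrite lerXn2r ?nnegrE ?(ltW ba)// lerDr.
  by rewrite ler_weXn2l// leq_subr.
split=> [j x jk xab|j x y kj xab yab].
  rewrite dE; apply: le_trans (interpolation_error h0 fC fM' jk _) _.
    by rewrite tD tE.
  apply: le_trans (hg j jk) _; rewrite ler_wpM2r ?exprn_ge0 ?(ltW g0)//.
  by rewrite ler_peMl// ler1n.
rewrite !dE; apply: le_trans (interpolation_error_lipschitz h0 fC fM' kj _ _) _.
- by rewrite tD tE.
- by rewrite tD tE.
rewrite ler_wpM2r// (_ : 2 * K * g = K * g + K * g) ?lerD//; last by ring.
  (* As k = j + 1, the first Lipschitz term times k + 2 is the second one, which [hg k] bounds. *)
  have -> : g = g ^+ (k.+1 - k) by rewrite subSnn.
  apply: le_trans (hg k (leqnn k)).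
  have -> : h^-1 ^+ k = h^-1 ^+ j * h^-1 by rewrite kj exprSr.
  rewrite (exprSr _ k); set u := (_ * h) ^+ k; set v := h^-1 ^+ j.
  have -> : M * (u * (k.+2%:R * h)) * (2 ^+ k * (v * h^-1))
      = M * u * (2 ^+ k * v) * k.+2%:R.
    by move: u v (2 ^+ k) (k.+2%:R) (lt0r_neq0 h0) => *; field.
  rewrite ler_peMr ?ler1n// !mulr_ge0// ?exprn_ge0// ?invr_ge0 ?(ltW h0)//.
  by rewrite mulr_ge0 // ltW.
by have := hg k (leqnn k); rewrite subSnn expr1.
Qed.

(** * Partial derivatives on the cube *)
Section PartialDerivatives.
Variables (R : realType) (n : nat).
Implicit Types (f g : 'cV[R]_n -> R) (x : 'cV[R]_n) (j : 'I_n).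

Definition is_pderive j f x (l : R) : Prop := pquot j f x @ cubeline j x --> l.

Lemma cube_line j x (t : R) : cube x ->
  cube (x + t *: delta_mx j 0) <-> 0 <= x j 0 + t <= 1.
Proof.
move=> cx; split=> [/(_ j)|xt i]; first by rewrite !mxE !eqxx mulr1.
rewrite !mxE eqxx andbT; have [->|ij] := eqVneq i j; first by rewrite mulr1.
by rewrite mulr0 addr0.
Qed.

Global Instance cubeline_filter j x : Filter (cubeline j x).
Proof. by rewrite /cubeline; exact: within_filter. Qed.

(** From any point of the cube one can move inwards by up to 1 / 2 along each axis, upwards or
    downwards according to the coordinate. *)
Lemma cubeline_proper j x : cube x -> ProperFilter (cubeline j x).
Proof.
move=> cx; apply: Build_ProperFilter_ex => A.
rewrite /cubeline /within/= => -[e /= e0 eA].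
have /andP[x0 x1] := cx j.
pose d := Num.min (e / 2) (1 / 2).
have d0 : 0 < d by rewrite lt_min !divr_gt0.
have de : d < e by rewrite gt_min ltr_pdivrMr// ltr_pMr// ltr1n.
have d1 : d <= 1 / 2 by rewrite ge_min lexx orbT.
have [xh|xh] := leP (x j 0) (1 / 2).
  exists d; apply: eA; rewrite ?gt_eqF//=.
    by rewrite sub0r normrN gtr0_norm.
  by apply/cube_line => //; apply/andP; split; lra.
exists (- d); apply: eA; rewrite ?oppr_eq0 ?gt_eqF//=.
  by rewrite sub0r opprK gtr0_norm.
by apply/cube_line => //; apply/andP; split; lra.
Qed.

Lemma cubeline_near j x (P : R -> Prop) :
  (forall t : R, t != 0 -> cube (x + t *: delta_mx j 0) -> P t) ->
  \forall t \near cubeline j x, P t.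
Proof.
move=> HP; rewrite /cubeline near_withinE /dnbhs near_withinE.
by near=> t => t0 ct; exact: HP.
Unshelve. all: by end_near. Qed.

Lemma is_pderiveE j f x l : cube x -> is_pderive j f x l -> pderive j f x = l.
Proof. by move=> cx fl; have := cubeline_proper j cx => ?; exact: cvg_lim fl. Qed.

Lemma is_pderive_pderivable j f x l : is_pderive j f x l -> pderivable j f x.
Proof. by move=> fl; apply/cvg_ex; exists l. Qed.

Lemma is_pderive_congr j f g x l : cube x -> (forall y, cube y -> f y = g y) ->
  is_pderive j f x l -> is_pderive j g x l.
Proof.
move=> cx fg; rewrite /is_pderive; apply: cvg_trans; apply: near_eq_cvg.
by apply: cubeline_near => t _ ct; rewrite /pquot !fg.
Qed.

(** Continuity along the line, on which the product and chain rules rely. *)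
Lemma is_pderive_cvg j f x l : is_pderive j f x l ->
  f (x + t *: delta_mx j 0) @[t --> cubeline j x] --> f x.
Proof.
move=> fl.
have t0 : t @[t --> cubeline j x] --> (0 : R).
  by apply: cvg_within_filter; apply: cvg_within_filter; exact: cvg_id.
have : t * pquot j f x t + f x @[t --> cubeline j x] --> 0 * l + f x.
  by apply: cvgD; [exact: cvgM|exact: cvg_cst].
rewrite mul0r add0r; apply: cvg_trans; apply: near_eq_cvg.
by apply: cubeline_near => t tn0 _; rewrite /pquot mulVKf// subrK.
Qed.

Lemma is_pderive_cst j (c : R) x : is_pderive j (fun=> c) x 0.
Proof.
rewrite /is_pderive (_ : pquot _ _ _ = fun=> 0); first exact: cvg_cst.
by apply/funext => t; rewrite /pquot subrr mulr0.
Qed.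

Lemma is_pderive_coord j i x :
  is_pderive j (fun y => y i 0) x (i == j)%:R.
Proof.
rewrite /is_pderive.
apply: (@cvg_trans _ (cst (i == j)%:R @ cubeline j x)); last exact: cvg_cst.
apply: near_eq_cvg; apply: cubeline_near => t t0 _.
rewrite /pquot !mxE eqxx andbT/=.
by rewrite addrAC subrr add0r mulKf.
Qed.

Lemma is_pderive_add j f g x l m : is_pderive j f x l -> is_pderive j g x m ->
  is_pderive j (fun y => f y + g y) x (l + m).
Proof.
move=> fl gm; rewrite /is_pderive.
rewrite (_ : pquot _ _ _ = fun t => pquot j f x t + pquot j g x t).
  exact: cvgD.
by apply/funext => t; rewrite /pquot; ring.
Qed.

Lemma is_pderive_mul j f g x l m : is_pderive j f x l -> is_pderive j g x m ->
  is_pderive j (fun y => f y * g y) x (l * g x + f x * m).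
Proof.
move=> fl gm; rewrite /is_pderive.
rewrite (_ : pquot _ _ _ = fun t => pquot j f x t * g (x + t *: delta_mx j 0)
  + f x * pquot j g x t).
  apply: cvgD; first by apply: cvgM => //; exact: is_pderive_cvg gm.
  by apply: cvgM => //; exact: cvg_cst.
by apply/funext => t; rewrite /pquot; ring.
Qed.

(** Caratheodory's form of the derivative of [u] avoids dividing by increments of [f], which may
    vanish. *)
Lemma is_pderive_comp j (u : R -> R) f x l d :
  is_derive (f x) 1 u d -> is_pderive j f x l ->
  is_pderive j (fun y => u (f y)) x (d * l).
Proof.
move=> /is_derive1_caratheodory[q [uq cq <-]] fl; rewrite /is_pderive.
rewrite (_ : pquot _ _ _ = fun t => q (f (x + t *: delta_mx j 0)) * pquot j f x t).
  by apply: cvgM => //; exact: cvg_comp (is_pderive_cvg fl) cq.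
by apply/funext => t; rewrite /pquot uq; ring.
Qed.

End PartialDerivatives.

(** * Rates of approximation of nets of functions *)
Section Rate.
Variable R : realType.

(** The constant is uniform in the grid size and in the point. Points are taken for sup bounds,
    pairs of points for Lipschitz bounds. *)
Definition rateO (T : Type) (X : set T) (w D : nat -> T -> R) : Prop :=
  exists2 K, 0 <= K &
    forall G x, (0 < G)%N -> X x -> `|D G x| <= K * w G x.

Variables (T : Type) (X : set T).
Implicit Types w D : nat -> T -> R.

Lemma rateO0 w D : (forall G x, 0 <= w G x) ->
  (forall G x, D G x = 0) -> rateO X w D.
Proof. by move=> w0 D0; exists 0 => // G x _ _; rewrite D0 normr0 mul0r. Qed.

Lemma rateO_eq w D D' :
  rateO X w D -> (forall G x, (0 < G)%N -> X x -> D' G x = D G x) -> rateO X w D'.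
Proof. by move=> [K K0 KD] E; exists K => // G x G0 Xx; rewrite E// KD. Qed.

Lemma rateO_weaken w w' D :
  rateO X w D -> (forall G x, (0 < G)%N -> X x -> w G x <= w' G x) -> rateO X w' D.
Proof.
move=> [K K0 KD] ww'; exists K => // G x G0 Xx.
by apply: le_trans (KD _ _ G0 Xx) _; rewrite ler_wpM2l// ww'.
Qed.

Lemma rateO_add w D D' : rateO X w D -> rateO X w D' ->
  rateO X w (fun G x => D G x + D' G x).
Proof.
move=> [K K0 KD] [K' K'0 KD']; exists (K + K'); first exact: addr_ge0.
by move=> G x G0 Xx; rewrite (le_trans (ler_normD _ _))// mulrDl lerD ?KD ?KD'.
Qed.

Lemma rateO_opp w D : rateO X w D -> rateO X w (fun G x => - D G x).
Proof. by move=> [K K0 KD]; exists K => // G x; rewrite normrN; exact: KD. Qed.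

Lemma rateO_mul w w' D D' : rateO X w D -> rateO X w' D' ->
  rateO X (fun G x => w G x * w' G x) (fun G x => D G x * D' G x).
Proof.
move=> [K K0 KD] [K' K'0 KD']; exists (K * K'); first exact: mulr_ge0.
by move=> G x G0 Xx; rewrite normrM mulrACA ler_pM ?KD ?KD'.
Qed.

(** The substitution may depend on [G], as it does when an inner network is plugged in. *)
Lemma rateO_pre (T' : Type) (Y : set T') (m : nat -> T' -> T) w D :
  rateO X w D -> (forall G y, (0 < G)%N -> Y y -> X (m G y)) ->
  rateO Y (fun G y => w G (m G y)) (fun G y => D G (m G y)).
Proof. by move=> [K K0 KD] XY; exists K => // G y G0 Yy; apply: KD => //; exact: XY. Qed.

End Rate.

Definition mesh {R : realType} (G : nat) : R := G%:R^-1.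

Lemma mesh_ge0 {R : realType} G : 0 <= mesh G :> R.
Proof. by rewrite invr_ge0. Qed.

Lemma mesh_leX {R : realType} G p q : (0 < G)%N -> (q <= p)%N ->
  mesh G ^+ p <= mesh G ^+ q :> R.
Proof.
by move=> G0 qp; rewrite ler_wiXn2l// ?mesh_ge0// invf_le1 ?ltr0n// ler1n.
Qed.

(** * Approximation estimates on the cube, their sums and products *)

Section NetClose.
Variables (R : realType) (n : nat).
Local Notation T := 'cV[R]_n.
Local Notation mesh := (@mesh R).

Definition dist1 (x y : T) : R := \sum_i `|x i 0 - y i 0|.

Lemma dist1_ge0 x y : 0 <= dist1 x y.
Proof. by apply: sumr_ge0 => i _. Qed.

Definition cube2 : set (T * T) := [set xy | cube xy.1 /\ cube xy.2].

(* The net H_G approximates F, up to order p - 1 for derivatives, at the rate of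
   splines of degree p; the Lipschitz clauses stand for derivatives of order p. *)
Fixpoint netclose (p : nat) (F : T -> R) (H : nat -> T -> R) : Prop :=
  [/\ rateO (@cube R n) (fun _ _ => 1) (fun _ => F),
      rateO (@cube R n) (fun G _ => mesh G ^+ p.+1) (fun G x => F x - H G x) &
      if p is p'.+1 then
        [/\ rateO cube2 (fun _ xy => dist1 xy.1 xy.2) (fun _ xy => F xy.1 - F xy.2),
            rateO cube2 (fun G xy => mesh G ^+ p * dist1 xy.1 xy.2)
              (fun G xy => F xy.1 - H G xy.1 - (F xy.2 - H G xy.2)) &
            (0 < p')%N -> forall j, exists F' H',
              [/\ forall x, cube x -> is_pderive j F x (F' x),
                  forall G x, (0 < G)%N -> cube x -> is_pderive j (H G) x (H' G x) &
                  netclose p' F' H']]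
      else True].

Lemma netclose_bounded p F H : netclose p F H ->
  rateO (@cube R n) (fun _ _ => 1) H.
Proof.
move=> cl; have [Fb FH] : rateO (@cube R n) (fun _ _ => 1) (fun _ => F) /\
   rateO (@cube R n) (fun G _ => mesh G ^+ p.+1) (fun G x => F x - H G x).
  by case: p cl => [|p] [].
have FH1 : rateO (@cube R n) (fun _ _ => 1) (fun G x => F x - H G x).
  by apply: rateO_weaken FH _ => G x G0 _; rewrite -(expr0 (mesh G)) mesh_leX.
by apply: rateO_eq (rateO_add Fb (rateO_opp FH1)) _ => G x _ _; ring.
Qed.

Lemma netclose_lipschitz p F H : netclose p.+1 F H ->
  rateO cube2 (fun _ xy => dist1 xy.1 xy.2) (fun G xy => H G xy.1 - H G xy.2).
Proof.
move=> [_ _ [Fl FHl _]].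
have FH1 : rateO cube2 (fun _ xy => dist1 xy.1 xy.2)
    (fun G xy => F xy.1 - H G xy.1 - (F xy.2 - H G xy.2)).
  apply: rateO_weaken FHl _ => G x G0 _; rewrite ler_piMl ?dist1_ge0//.
  by rewrite -(expr0 (mesh G)) mesh_leX.
by apply: rateO_eq (rateO_add Fl (rateO_opp FH1)) _ => G x _ _; ring.
Qed.

(** The product and chain rules multiply derivatives by undifferentiated factors, which must first
    be lowered to the same level. *)
Lemma netcloseW p F H : netclose p.+1 F H -> netclose p F H.
Proof.
elim: p F H => [|p IHp] F H [Fb FH [Fl FHl D]].
  by split => //; apply: rateO_weaken FH _ => G x G0 _; exact: mesh_leX.
split => //; first by apply: rateO_weaken FH _ => G x G0 _; exact: mesh_leX.
split => //.
  by apply: rateO_weaken FHl _ => G x G0 _; rewrite ler_wpM2r ?dist1_ge0 ?mesh_leX.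
move=> p0 j; have [F' [H' [FF' HH' FH']]] := D isT j.
by exists F', H'; split => //; exact: IHp.
Qed.

Let w_ge0 p (G : nat) (xy : T * T) : 0 <= mesh G ^+ p * dist1 xy.1 xy.2.
Proof. by rewrite mulr_ge0 ?exprn_ge0 ?mesh_ge0 ?dist1_ge0. Qed.

Lemma netclose_cst p (c : R) : netclose p (fun=> c) (fun _ _ => c).
Proof.
elim: p c => [|p IHp] c; split.
- by exists `|c| => // G x _ _; rewrite mulr1.
- by apply: rateO0 => G x; rewrite ?subrr// exprn_ge0 ?mesh_ge0.
- by [].
- by exists `|c| => // G x _ _; rewrite mulr1.
- by apply: rateO0 => G x; rewrite ?subrr// exprn_ge0 ?mesh_ge0.
split.
- by apply: rateO0 => G x; rewrite ?subrr ?dist1_ge0.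
- by apply: rateO0 => G x; rewrite ?subrr.
- move=> _ j; exists (fun=> 0), (fun _ _ => 0).
  by split => *; [exact: is_pderive_cst|exact: is_pderive_cst|exact: IHp].
Qed.

Lemma netclose_coord p (i : 'I_n) : netclose p (fun x => x i 0) (fun _ x => x i 0).
Proof.
have b : rateO (@cube R n) (fun _ _ => 1) (fun _ x => x i 0).
  exists 1 => // G x _ /(_ i)/andP[x0 x1]; rewrite mulr1 ger0_norm//.
have z q : rateO (@cube R n) (fun G _ => mesh G ^+ q) (fun G x => x i 0 - x i 0).
  by apply: rateO0 => G x; rewrite ?subrr// exprn_ge0 ?mesh_ge0.
case: p => [|p]; split => //; split.
- exists 1 => // G [x y] _ _ /=; rewrite mul1r /dist1 (bigD1 i)//= lerDl.
  exact: sumr_ge0.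
- by apply: rateO0 => G x; rewrite ?subrr.
- move=> _ j; exists (fun=> (i == j)%:R), (fun _ _ => (i == j)%:R).
  by split => *; [exact: is_pderive_coord|exact: is_pderive_coord|exact: netclose_cst].
Qed.

Lemma netclose_add p F1 H1 F2 H2 : netclose p F1 H1 -> netclose p F2 H2 ->
  netclose p (fun x => F1 x + F2 x) (fun G x => H1 G x + H2 G x).
Proof.
elim: p F1 H1 F2 H2 => [|p IHp] F1 H1 F2 H2 [F1b FH1 C1] [F2b FH2 C2];
  (split; [exact: rateO_add|
    by apply: rateO_eq (rateO_add FH1 FH2) _ => G x _ _; ring|]) => //.
case: C1 C2 => [F1l FH1l D1] [F2l FH2l D2]; split.
- by apply: rateO_eq (rateO_add F1l F2l) _ => G x _ _; ring.
- by apply: rateO_eq (rateO_add FH1l FH2l) _ => G x _ _; ring.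
- move=> p0 j; have [F1' [H1' [? ? ?]]] := D1 p0 j.
  have [F2' [H2' [? ? ?]]] := D2 p0 j.
  exists (fun x => F1' x + F2' x), (fun G x => H1' G x + H2' G x).
  by split => *; [apply: is_pderive_add; auto|apply: is_pderive_add; auto|exact: IHp].
Qed.

Lemma netclose_sum p m (F : 'I_m -> T -> R) (H : 'I_m -> nat -> T -> R) :
  (forall i, netclose p (F i) (H i)) ->
  netclose p (fun x => \sum_(i < m) F i x) (fun G x => \sum_(i < m) H i G x).
Proof.
elim: m F H => [|m IHm] F H FH.
  under eq_fun do rewrite big_ord0.
  rewrite [X in netclose _ _ X](_ : _ = fun _ _ => 0); first exact: netclose_cst.
  by apply/funext => G; apply/funext => x; rewrite big_ord0.
under eq_fun do rewrite big_ord_recl.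
rewrite [X in netclose _ _ X](_ : _ = fun G x => H ord0 G x
    + \sum_(i < m) H (lift ord0 i) G x); last first.
  by apply/funext => G; apply/funext => x; rewrite big_ord_recl.
by apply: netclose_add => //; apply: (IHm (fun i => F (lift ord0 i)) (fun i => H (lift ord0 i))).
Qed.

Lemma netclose_mul p F1 H1 F2 H2 : netclose p F1 H1 -> netclose p F2 H2 ->
  netclose p (fun x => F1 x * F2 x) (fun G x => H1 G x * H2 G x).
Proof.
elim: p F1 H1 F2 H2 => [|p IHp] F1 H1 F2 H2 C1 C2.
  have H1b := netclose_bounded C1.
  case: (C1) (C2) => [F1b FH1 _] [F2b FH2 _]; split=> //.
    by apply: rateO_weaken (rateO_mul F1b F2b) _ => *; rewrite mulr1.
  apply: (@rateO_eq _ _ _ _ (fun G x => (F1 x - H1 G x) * F2 x + H1 G x * (F2 x - H2 G x))).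
    apply: rateO_add; [have := rateO_mul FH1 F2b|have := rateO_mul H1b FH2];
      by move=> /rateO_weaken; apply => *; rewrite ?mulr1 ?mul1r.
  by move=> G x _ _; ring.
have H1b := netclose_bounded C1; have H1l := netclose_lipschitz C1.
have W1 := netcloseW C1; have W2 := netcloseW C2.
case: C1 C2 => [F1b FH1 [F1l FH1l D1]] [F2b FH2 [F2l FH2l D2]].
have fst2 (w : nat -> R) (D : nat -> T -> R) : rateO (@cube R n) (fun G _ => w G) D ->
    rateO cube2 (fun G _ => w G) (fun G xy => D G xy.1).
  by move=> /(@rateO_pre _ _ _ _ cube2 (fun _ xy => xy.1)); apply=> G xy _ [].
have snd2 (w : nat -> R) (D : nat -> T -> R) : rateO (@cube R n) (fun G _ => w G) D ->
    rateO cube2 (fun G _ => w G) (fun G xy => D G xy.2).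
  by move=> /(@rateO_pre _ _ _ _ cube2 (fun _ xy => xy.2)); apply=> G xy _ [].
split.
- by apply: rateO_weaken (rateO_mul F1b F2b) _ => *; rewrite mulr1.
- apply: (@rateO_eq _ _ _ _ (fun G x => (F1 x - H1 G x) * F2 x + H1 G x * (F2 x - H2 G x))).
    apply: rateO_add; [have := rateO_mul FH1 F2b|have := rateO_mul H1b FH2];
      by move=> /rateO_weaken; apply => *; rewrite ?mulr1 ?mul1r.
  by move=> G x _ _; ring.
split.
- apply: (@rateO_eq _ _ _ _ (fun _ xy => (F1 xy.1 - F1 xy.2) * F2 xy.1
      + F1 xy.2 * (F2 xy.1 - F2 xy.2))).
    apply: rateO_add; [have := rateO_mul F1l (fst2 _ _ F2b)|have := rateO_mul (snd2 _ _ F1b) F2l];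
      by move=> /rateO_weaken; apply => *; rewrite ?mulr1 ?mul1r.
  by move=> G x _ _; ring.
(* In the outer terms the rate comes from a second difference; in the middle ones from a plain error
   of order p + 2, one more than needed, times a distance. *)
- apply: (@rateO_eq _ _ _ _ (fun G xy =>
       ((F1 xy.1 - H1 G xy.1 - (F1 xy.2 - H1 G xy.2)) * F2 xy.1
      + (F1 xy.2 - H1 G xy.2) * (F2 xy.1 - F2 xy.2))
      + ((H1 G xy.1 - H1 G xy.2) * (F2 xy.1 - H2 G xy.1)
      + H1 G xy.2 * (F2 xy.1 - H2 G xy.1 - (F2 xy.2 - H2 G xy.2))))).
    apply: rateO_add; apply: rateO_add;
      [have := rateO_mul FH1l (fst2 _ _ F2b)|have := rateO_mul (snd2 _ _ FH1) F2l
      |have := rateO_mul H1l (fst2 _ _ FH2)|have := rateO_mul (snd2 _ _ H1b) FH2l];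
      move=> /rateO_weaken; apply => G xy G0 _; rewrite ?mulr1 ?mul1r//.
      by rewrite ler_wpM2r ?dist1_ge0// mesh_leX.
    by rewrite mulrC ler_wpM2r ?dist1_ge0// mesh_leX.
  by move=> G x _ _; ring.
- move=> p0 j; have [F1' [H1' [? ? ?]]] := D1 p0 j.
  have [F2' [H2' [? ? ?]]] := D2 p0 j.
  exists (fun x => F1' x * F2 x + F1 x * F2' x),
    (fun G x => H1' G x * H2 G x + H1 G x * H2' G x).
  split=> [x cx|G x G0 cx|]; try by apply: is_pderive_mul; auto.
  by apply: netclose_add; apply: IHp.
Qed.

End NetClose.

(** * Difference estimates for smooth functions of one variable *)

Section Smooth.
Variable R : realType.
Implicit Types f : R -> R.

Lemma Ck_continuous k f j : Ck k f -> (j <= k)%N -> continuous (derive1n j f).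
Proof.
move=> [df cf]; rewrite leq_eqVlt => /orP[/eqP->//|jk] x.
by apply/differentiable_continuous/derivable1_diffP; exact: df.
Qed.

Lemma Ck_derive1 k f : Ck k.+1 f -> Ck k (derive1 f).
Proof.
by move=> [df cf]; split=> [j jk x|]; rewrite -derive1Sn//; exact: df.
Qed.

Lemma itv_between (M u v z : R) : `|u| <= M -> `|v| <= M ->
  Num.min u v <= z <= Num.max u v -> `|z| <= M.
Proof.
rewrite !ler_norml /Num.min /Num.max => /andP[? ?] /andP[? ?].
by case: ltP => _ /andP[? ?]; apply/andP; split; lra.
Qed.

Lemma Ck_lipschitz k f (M : R) : Ck k.+1 f ->
  exists2 K, 0 <= K & forall u v, `|u| <= M -> `|v| <= M ->
    `|f u - f v| <= K * `|u - v|.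
Proof.
move=> fC; have [K K0 fK] := continuous_bounded_itv (- M) M
  (Ck_continuous (j := 1) fC isT).
exists K => // u v uM vM; apply: lipschitz_derive => z /(itv_between uM vM) zM.
  exact: (Ck_is_derive (j := 0) z fC).
by apply: fK; rewrite -ler_norml.
Qed.

(** Move from u0 to u1 and from v0 to v1 simultaneously and apply the mean value inequality to the
    difference of the values of [f]. It serves with u = F and v = H_G at two points, making the last
    term a product of an error and a distance. *)
Lemma Ck_second_difference k f (M : R) : Ck k.+2 f ->
  exists2 K, 0 <= K & forall u0 u1 v0 v1,
    `|u0| <= M -> `|u1| <= M -> `|v0| <= M -> `|v1| <= M ->
    `|f u1 - f v1 - (f u0 - f v0)| <= K * `|u1 - v1 - (u0 - v0)|
      + K * ((`|u0 - v0| + `|u1 - v1|) * `|v1 - v0|).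
Proof.
move=> fC; have [K1 K10 fK1] := continuous_bounded_itv (- M) M
  (Ck_continuous (j := 1) fC isT).
have [K2 K20 fK2] := Ck_lipschitz M (Ck_derive1 fC).
exists (K1 + K2); first exact: addr_ge0.
move=> u0 u1 v0 v1 u0M u1M v0M v1M.
pose u s := u0 + s * (u1 - u0); pose v s := v0 + s * (v1 - v0).
have seg p q s : `|p| <= M -> `|q| <= M -> 0 <= s <= 1 -> `|p + s * (q - p)| <= M.
  move=> pM qM /andP[s0 s1]; have -> : p + s * (q - p) = (1 - s) * p + s * q by ring.
  rewrite (le_trans (ler_normD _ _))// !normrM (ger0_norm s0).
  rewrite (@ger0_norm _ (1 - s)) ?subr_ge0//.
  have -> : M = (1 - s) * M + s * M by ring.
  by rewrite lerD// ler_wpM2l// subr_ge0.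
have Did (s : R) : is_derive s 1 (fun y : R => y) 1 by exact: is_derive_id.
have Dc (c s : R) : is_derive s 1 (fun=> c) 0 by exact: is_derive_cst.
have Df (y : R) : is_derive y 1 f (derive1n 1 f y) := Ck_is_derive (j := 0) y fC isT.
have Dseg (p q s : R) : is_derive s 1 (fun s => f (p + s * (q - p)))
    (derive1n 1 f (p + s * (q - p)) * (q - p)).
  apply: (is_derive_val (is_derive1_comp (Df _)
    (is_derive_add (Dc p s) (is_derive_mul (Did s) (Dc (q - p) s))))).
  by rewrite mulr0 add0r mulr1 add0r.
have D s := is_derive_sub (Dseg u0 u1 s) (Dseg v0 v1 s).
pose gam s := f (u0 + s * (u1 - u0)) - f (v0 + s * (v1 - v0)).
have : `|gam 1 - gam 0| <= ((K1 + K2) * `|u1 - v1 - (u0 - v0)|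
      + (K1 + K2) * ((`|u0 - v0| + `|u1 - v1|) * `|v1 - v0|)) * `|1 - 0 : R|.
  apply: (lipschitz_derive (fun s _ => D s)) => s; rewrite -/(u s) -/(v s).
  rewrite minC maxC min_l// max_r// => s01.
  have -> : derive1n 1 f (u s) * (u1 - u0) - derive1n 1 f (v s) * (v1 - v0) =
      derive1n 1 f (u s) * (u1 - v1 - (u0 - v0))
      + (derive1n 1 f (u s) - derive1n 1 f (v s)) * (v1 - v0) by ring.
  rewrite (le_trans (ler_normD _ _))// lerD// normrM.
    rewrite ler_wpM2r// (@le_trans _ _ K1) ?lerDl//.
    by apply: fK1; rewrite -ler_norml seg.
  rewrite mulrA ler_wpM2r//.
  apply: le_trans (fK2 _ _ (seg _ _ _ u0M u1M s01) (seg _ _ _ v0M v1M s01)) _.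
  have -> : u s - v s = (1 - s) * (u0 - v0) + s * (u1 - v1) by rewrite /u /v; ring.
  case/andP: s01 => s0 s1.
  rewrite ler_pM// ?lerDr// (le_trans (ler_normD _ _))// lerD// normrM.
    by rewrite ler_piMl// ger0_norm; lra.
  by rewrite ler_piMl// ger0_norm; lra.
by rewrite /gam !mul1r !mul0r !addr0 ![_ + (_ - _)]addrC !subrK subr0 normr1 mulr1.
Qed.

End Smooth.

(** * Approximation in one variable and composition *)

Section NetClose1.
Variable R : realType.
Implicit Types (f : R -> R) (psi : nat -> R -> R).
Local Notation mesh := (@mesh R).

Definition ball0 (M : R) : set R := [set y | `|y| <= M].
Definition ball02 (M : R) : set (R * R) := [set y | ball0 M y.1 /\ ball0 M y.2].

(* One-variable counterpart of [netclose], on [-M, M]. *)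
Fixpoint netclose1 (M : R) (p : nat) f psi : Prop :=
  rateO (ball0 M) (fun G _ => mesh G ^+ p.+1) (fun G y => f y - psi G y) /\
  if p is p'.+1 then
    rateO (ball02 M) (fun G y => mesh G ^+ p * `|y.1 - y.2|)
      (fun G y => f y.1 - psi G y.1 - (f y.2 - psi G y.2)) /\
    ((0 < p')%N -> exists2 psi',
      forall G y, (0 < G)%N -> ball0 M y -> is_derive y 1 (psi G) (psi' G y) &
      netclose1 M p' (derive1 f) psi')
  else True.

(** Serves for the sigmoid, which stays exact in the approximating networks. *)
Lemma netclose1_refl M p f : Ck p f -> netclose1 M p f (fun _ => f).
Proof.
elim: p f => [|p IHp] f fC; split=> //.
- by apply: rateO0 => G x; rewrite ?subrr// exprn_ge0 ?mesh_ge0.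
- by apply: rateO0 => G x; rewrite ?subrr// exprn_ge0 ?mesh_ge0.
split; first by apply: rateO0 => G x; rewrite ?subrr// mulr_ge0 ?exprn_ge0 ?mesh_ge0.
move=> p0; exists (fun _ => derive1 f); last exact: IHp (Ck_derive1 fC).
by move=> G y _ _; exact: (Ck_is_derive (j := 0) y fC).
Qed.

Lemma netclose1_dinterp (M : R) (k : nat) f : 0 <= M -> Ck k.+1 f ->
  netclose1 M k f (fun G => dinterp k G (- (M + 1)) (M + 1) f 0).
Proof.
(* The error estimate holds on [a, b) with a < b; the margin 1 puts [-M, M] inside, even for M =
   0. *)
move=> M0 fC; set a := - (M + 1); set b := M + 1.
have ab : a < b by rewrite /a /b; lra.
have [K K0 E] := dinterp_error ab fC.
have Mab y : ball0 M y -> a <= y < b.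
  by rewrite /ball0/= ler_norml => /andP[? ?]; rewrite /a /b; apply/andP; split; lra.
suff H p j : (p + j)%N = k ->
    netclose1 M p (derive1n j f) (fun G => dinterp k G a b f j).
  by rewrite -[f in netclose1 _ _ f _](derive1n0 f); apply: H; rewrite addn0.
elim: p j => [|p IHp] j pjk; split => //.
- exists K => // G y G0 yM; have [/(_ j y) + _] := E G G0.
  have -> : (k.+1 - j = 1)%N by lia.
  by apply; [lia|exact: Mab].
- exists K => // G y G0 yM; have [/(_ j y) + _] := E G G0.
  have -> : (k.+1 - j = p.+2)%N by lia.
  by apply; [lia|exact: Mab].
split.
- exists K => // G [x y] G0 [/= xM yM]; rewrite mulrA.
  (* For j = k - 1 the spline derivative need not be differentiable and the separate Lipschitz
     estimate applies; below, the error of the next derivative suffices. *)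
  case: p IHp pjk => [|p] IHp pjk.
    have [_ /(_ j x y)] := E G G0; rewrite expr1.
    by apply; [lia|exact: Mab|exact: Mab].
  apply: (@lipschitz_derive _ (fun x => derive1n j f x - dinterp k G a b f j x)
    (fun x => derive1n j.+1 f x - dinterp k G a b f j.+1 x)) => z /(itv_between xM yM) zM.
    have jk : (j < k.+1)%N by lia.
    have jk' : (j.+1 < k)%N by lia.
    exact: (is_derive_sub (Ck_is_derive z fC jk) (is_derive_dinterp f z ab G0 jk')).
  have [/(_ j.+1 z) + _] := E G G0.
  have -> : (k.+1 - j.+1 = p.+2)%N by lia.
  by apply; [lia|exact: Mab].
- move=> p0; exists (fun G => dinterp k G a b f j.+1).
    by move=> G y G0 yM; apply: is_derive_dinterp => //; lia.
  by rewrite -derive1nS; apply: IHp; lia.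
Qed.

Lemma netclose_comp0 n (M : R) p f psi (F : 'cV[R]_n -> R) H :
    Ck p.+1 f -> netclose1 M p f psi -> netclose p F H ->
    (forall x, cube x -> `|F x| <= M) ->
    (forall G x, (0 < G)%N -> cube x -> `|H G x| <= M) ->
  rateO (@cube R n) (fun _ _ => 1) (fun _ x => f (F x)) /\
  rateO (@cube R n) (fun G _ => mesh G ^+ p.+1) (fun G x => f (F x) - psi G (H G x)).
Proof.
move=> fC fpsi FH FM HM; split.
  have [K K0 fK] := continuous_bounded_itv (- M) M (Ck_continuous (j := 0) fC isT).
  by exists K => // G x _ cx; rewrite mulr1; apply: fK; rewrite -ler_norml FM.
have [L L0 fL] := Ck_lipschitz M fC.
have [C C0 FHC] : rateO (@cube R n) (fun G _ => mesh G ^+ p.+1) (fun G x => F x - H G x).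
  by case: p FH {fC fpsi} => [|p] [].
have fp : rateO (ball0 M) (fun G _ => mesh G ^+ p.+1) (fun G y => f y - psi G y).
  by case: p fpsi {fC FH FHC} => [|p] [].
apply: (@rateO_eq _ _ _ _ (fun G x => (f (F x) - f (H G x))
    + (f (H G x) - psi G (H G x)))); last by move=> G x _ _; ring.
apply: rateO_add; last exact: (rateO_pre fp (fun G x G0 cx => HM G x G0 cx)).
exists (L * C) => [|G x G0 cx]; first exact: mulr_ge0.
apply: le_trans (fL _ _ (FM _ cx) (HM _ _ G0 cx)) _.
by rewrite -mulrA ler_wpM2l// FHC.
Qed.

Lemma netclose_comp n (M : R) p f psi (F : 'cV[R]_n -> R) H :
    Ck p.+1 f -> netclose1 M p f psi -> netclose p F H ->
    (forall x, cube x -> `|F x| <= M) ->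
    (forall G x, (0 < G)%N -> cube x -> `|H G x| <= M) ->
  netclose p (fun x => f (F x)) (fun G x => psi G (H G x)).
Proof.
elim: p f psi F H => [|p IHp] f psi F H fC fpsi FH FM HM;
  have [fFb bd] := netclose_comp0 fC fpsi FH FM HM; first by split.
have [L L0 fL] := Ck_lipschitz M fC.
have Hl := netclose_lipschitz FH; have FH' := netcloseW FH.
case: FH => [[KF KF0 Fb] [KD KD0 FHb] [[LF LF0 Fl] [LD LD0 FHl] D]].
case: Hl => LH LH0 Hl; case: fpsi => fp [fpl fpD].
split => //; split.
- exists (L * LF) => [|G [x y] G0 [/= cx cy]]; first exact: mulr_ge0.
  apply: le_trans (fL _ _ (FM _ cx) (FM _ cy)) _.
  by rewrite -mulrA ler_wpM2l// (Fl 1 (x, y)).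
- have [C C0 fC2] := Ck_second_difference M fC.
  (* Pass through f composed with H_G: first F is replaced by H_G inside f, then f by psi_G at
     values of H_G. *)
  apply: (@rateO_eq _ _ _ _ (fun G xy =>
      (f (F xy.1) - f (H G xy.1) - (f (F xy.2) - f (H G xy.2)))
      + (f (H G xy.1) - psi G (H G xy.1) - (f (H G xy.2) - psi G (H G xy.2))))).
    apply: rateO_add.
      exists (C * LD + C * (2 * KD * LH)) => [|G [x y] G0 [/= cx cy]].
        by rewrite addr_ge0 ?mulr_ge0.
      apply: le_trans (fC2 _ _ _ _ (FM _ cy) (FM _ cx) (HM _ _ G0 cy) (HM _ _ G0 cx)) _.
      rewrite [leRHS]mulrDl lerD// -[leRHS]mulrA ler_wpM2l//.
        exact: (FHl G (x, y)).
      apply: (@le_trans _ _ (2 * KD * mesh G ^+ p.+2 * (LH * dist1 x y))).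
        rewrite ler_pM ?addr_ge0//; last exact: (Hl G (x, y)).
        by rewrite -mulrA mulr_natl mulr2n lerD// FHb.
      rewrite (_ : 2 * KD * _ * _ = 2 * KD * LH * (mesh G ^+ p.+2 * dist1 x y)).
        rewrite ler_wpM2l ?mulr_ge0// ler_wpM2r ?dist1_ge0//.
        exact: mesh_leX.
      by ring.
    have [C' C'0 fC'] := fpl.
    exists (C' * LH) => [|G [x y] G0 [/= cx cy]]; first exact: mulr_ge0.
    have /= := fC' G (H G x, H G y) G0 (conj (HM _ _ G0 cx) (HM _ _ G0 cy)).
    move=> /le_trans; apply; rewrite -[leRHS]mulrA ler_wpM2l// mulrCA.
    by rewrite ler_wpM2l ?exprn_ge0 ?mesh_ge0// (Hl G (x, y)).
  by move=> G xy _ _; ring.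
- move=> p0 j; have [F' [H' [FF' HH' FH'']]] := D p0 j.
  have [psi' psiD fpsi'] := fpD p0.
  exists (fun x => derive1 f (F x) * F' x), (fun G x => psi' G (H G x) * H' G x).
  split=> [x cx|G x G0 cx|].
  - apply: is_pderive_comp (FF' x cx).
    exact: (Ck_is_derive (j := 0) (F x) fC).
  - apply: is_pderive_comp (HH' G x G0 cx).
    by apply: psiD => //; exact: HM.
  (* The outer derivative falls under the induction hypothesis, with the inner net lowered by one
     level. *)
  - by apply: netclose_mul => //; apply: IHp => //; exact: Ck_derive1.
Qed.

End NetClose1.

(** * Iterated partial derivatives and the C^m norm *)
Section IteratedDerivatives.
Variables (R : realType) (n : nat).
Implicit Types (f g : 'cV[R]_n -> R) (x : 'cV[R]_n) (j : 'I_n) (s : seq 'I_n).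

(** Equality of the filters transfers existence and value of the derivative at once. *)
Lemma pquot_filter_congr j f g x : cube x -> (forall y, cube y -> f y = g y) ->
  pquot j f x @ cubeline j x = pquot j g x @ cubeline j x.
Proof.
move=> cx fg.
have E : \forall t \near cubeline j x, pquot j f x t = pquot j g x t.
  by apply: cubeline_near => t _ ct; rewrite /pquot !fg.
by apply/predeqP => A; split; apply: filterS2 E => t /= ->.
Qed.

Lemma iter_pderive_congr s f g : (forall y, cube y -> f y = g y) ->
  forall x, cube x -> iter_pderive s f x = iter_pderive s g x.
Proof.
move=> fg; elim: s => [|j s IHs] x cx /=; first exact: fg.
by rewrite /pderive (pquot_filter_congr j cx IHs).
Qed.

Lemma iter_pderivable_congr s f g : (forall y, cube y -> f y = g y) ->
  forall x, cube x -> iter_pderivable s f x -> iter_pderivable s g x.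
Proof.
move=> fg; elim: s => [//|j s IHs] x cx /= [fs fj]; split.
  by apply: filterS fs => t ft ct; apply: IHs (ft ct).
by rewrite /pderivable -(pquot_filter_congr j cx (iter_pderive_congr s fg)).
Qed.

(** The innermost derivative, last in the list, is the one that [netclose] supplies. *)
Lemma iter_pderivable_rcons s j f x : (forall y, cube y -> pderivable j f y) ->
  cube x -> iter_pderivable (rcons s j) f x <-> iter_pderivable s (pderive j f) x.
Proof.
move=> fj; elim: s x => [|i s IHs] x cx /=.
  by split=> // _; split; [by near=> t|exact: fj].
rewrite /iter_pderive foldr_rcons -/(iter_pderive s _).
split=> -[sx ix]; split=> //; apply: filterS sx => t st ct.
  by apply/IHs => //; exact: st.
by apply/IHs => //; exact: st.
Unshelve. all: by end_near. Qed.

Lemma pderive_lipschitz j f x (K : R) : cube x ->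
    (forall y, cube y -> `|f y - f x| <= K * dist1 y x) ->
  pderivable j f x -> `|pderive j f x| <= K.
Proof.
move=> cx fK fj; have PF := cubeline_proper j cx.
have lim : `|pquot j f x t| @[t --> cubeline j x] --> `|pderive j f x|.
  exact: cvg_norm fj.
apply: (cvgr_to_le lim); apply: cubeline_near => t t0 ct.
rewrite /pquot normrM normfV ler_pdivrMl ?normr_gt0// mulrC.
have -> : `|t| = dist1 (x + t *: delta_mx j 0) x; last exact: fK.
rewrite /dist1 (bigD1 j)//= !mxE !eqxx mulr1.
rewrite [x j 0 + t]addrC addrK big1 ?addr0// => i ij.
by rewrite !mxE (negbTE ij) mulr0 addr0 subrr normr0.
Qed.

(** At order p existence is not claimed and the bound is conditional, matching the restricted
    supremum of the norm. *)
Definition iter_bound (p : nat) (D : nat -> 'cV[R]_n -> R) (K : R) s :=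
  forall G x, (0 < G)%N -> cube x ->
    ((size s < p)%N -> iter_pderivable s (D G) x) /\
    (iter_pderivable s (D G) x ->
       `|iter_pderive s (D G) x| <= K * mesh G ^+ (p.+1 - size s)).

Lemma netclose_iter p (F : 'cV[R]_n -> R) H : netclose p F H ->
  exists2 K, 0 <= K & forall s, (size s <= p)%N ->
    iter_bound p (fun G x => F x - H G x) K s.
Proof.
elim: p F H => [|p IHp] F H [_ [K K0 FH] C].
  by exists K => // -[|//] _ G x G0 cx; split=> // _; exact: FH.
case: C => [_ [L L0 FHl] D].
have : forall j, exists K, 0 <= K /\ forall s, (size s <= p)%N ->
    iter_bound p.+1 (fun G x => F x - H G x) K (rcons s j).
  (* At level 1 no derivative is supplied: where one exists, the Lipschitz constant bounds it. *)
  move=> j; case: p => [|p] in IHp K K0 FH FHl D *.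
    exists L; split=> // -[|//] _ G x G0 cx; split=> //= -[_ fj]; rewrite expr1.
    apply: pderive_lipschitz fj => // y cy.
    by have := FHl G (y, x) G0 (conj cy cx); rewrite expr1 mulrA.
  have [F' [H' [FF' HH' FH']]] := D isT j.
  have [K' K'0 FHK'] := IHp F' H' FH'.
  exists K'; split => // s sp G x G0 cx.
  have dFH y : cube y -> is_pderive j (fun x => F x - H G x) y (F' y - H' G y).
    move=> cy; have := is_pderive_add (FF' y cy)
      (is_pderive_mul (is_pderive_cst j (-1) y) (HH' G y G0 cy)).
    rewrite mul0r add0r mulN1r; apply: is_pderive_congr => // z _.
    by rewrite mulN1r.
  have E y : cube y -> pderive j (fun x => F x - H G x) y = F' y - H' G y.
    by move=> cy; apply: is_pderiveE => //; exact: dFH.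
  have E' y : cube y -> F' y - H' G y = pderive j (fun x => F x - H G x) y.
    by move=> cy; rewrite E.
  have dj y : cube y -> pderivable j (fun x => F x - H G x) y.
    by move=> cy; exact: is_pderive_pderivable (dFH y cy).
  have [A B] := FHK' s sp G x G0 cx.
  rewrite size_rcons; split=> [sp'|/(iter_pderivable_rcons s dj cx) sj].
    apply/(iter_pderivable_rcons s dj cx).
    exact: iter_pderivable_congr E' x cx (A sp').
  rewrite /iter_pderive foldr_rcons -/(iter_pderive s _) (iter_pderive_congr s E cx).
  by rewrite subSS; apply: B; exact: iter_pderivable_congr E x cx sj.
(* [K] serves the empty list and [B j] the lists ending in [j]; the sum serves all. *)
move=> /choice[B HB]; exists (K + \sum_j B j).
  by rewrite addr_ge0// sumr_ge0// => j _; exact: (HB j).1.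
case/lastP => [|s j] sp G x G0 cx.
  split=> // _; apply: le_trans (FH G x G0 cx) _; rewrite ler_wpM2r ?exprn_ge0 ?mesh_ge0//.
  by rewrite lerDl sumr_ge0// => j _; exact: (HB j).1.
rewrite size_rcons in sp; have [S1 S2] := (HB j).2 s sp G x G0 cx.
split=> // /S2/le_trans; apply; rewrite ler_wpM2r ?exprn_ge0 ?mesh_ge0//.
rewrite (bigD1 j)//= addrCA lerDl addr_ge0// sumr_ge0// => i _.
exact: (HB i).1.
Qed.

Lemma size_midx_seq (beta : 'I_n -> nat) : size (midx_seq beta) = midx_order beta.
Proof.
rewrite /midx_seq size_flatten /shape -map_comp sumnE big_map /midx_order.
by rewrite -big_enum; apply: eq_bigr => i _; rewrite /= size_nseq.
Qed.

Lemma netclose_Cnorm k (F V : 'cV[R]_n -> R) H : netclose k F H ->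
    (forall x, cube x -> V x = F x) ->
  exists K, forall G m, (0 < G)%N -> (m <= k)%N ->
    (Cnorm k m (fun x => V x - H G x)%R <=
      (K * G%:R ^ (- k%:Z - 1 + m%:Z))%R%:E)%E.
Proof.
move=> /netclose_iter[K K0 FK] VF; exists K => G m G0 mk.
have -> : G%:R ^ (- k%:Z - 1 + m%:Z) = mesh G ^+ (k.+1 - m) :> R.
  have -> : - k%:Z - 1 + m%:Z = - (k.+1 - m)%:Z by lia.
  by rewrite -exprz_inv.
apply/bigmax_leP; split=> [|beta bm].
  by rewrite lee_fin mulr_ge0 ?exprn_ge0 ?mesh_ge0.
apply: ub_ereal_sup => _ [x [cx bk] <-].
set b := fun i => beta i : nat; rewrite -/b in bm bk.
have VFG y : cube y -> F y - H G y = V y - H G y by move=> cy; rewrite VF.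
have VFG' y : cube y -> V y - H G y = F y - H G y by move=> cy; rewrite VF.
have sb : (size (midx_seq b) <= k)%N by rewrite size_midx_seq (leq_trans bm).
have [A B] := FK _ sb G x G0 cx.
(* Existence keeps [Dabs] finite: below order k it is proved, at order k it comes from the
   restriction of the supremum. *)
have ex : Dexists b (fun x => V x - H G x) x.
  have [bk'|bk'] := eqVneq (midx_order b) k; first exact: bk.
  apply: (iter_pderivable_congr VFG cx); apply: A.
  by rewrite size_midx_seq ltn_neqAle bk' (leq_trans bm).
rewrite /Dabs; case: asboolP => // _; rewrite lee_fin /Dmulti.
rewrite (iter_pderive_congr _ VFG' cx).
apply: le_trans (B (iter_pderivable_congr VFG' cx ex)) _.
by rewrite ler_wpM2l// mesh_leX// leq_sub2l// size_midx_seq.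
Qed.

End IteratedDerivatives.

(** * Networks *)
Section Sigmoid.
Variable R : realType.
Local Notation S := (@sigmoid R).

Lemma is_derive_sigmoid (x : R) : is_derive x 1 S (S x * (1 - S x)).
Proof.
have Did : is_derive x 1 (fun y : R => - y) (- 1) by exact: is_deriveN.
have De : is_derive x 1 (fun y : R => expR (- y)) (expR (- x) * - 1).
  by apply: (is_derive1_comp (g := fun y : R => - y)).
have D1 : is_derive x 1 (fun y : R => 1 + expR (- y)) (0 + expR (- x) * - 1).
  by apply: is_derive_add => //; exact: is_derive_cst.
have e0 : 1 + expR (- x) != 0 by rewrite gt_eqF// addr_gt0// expR_gt0.
have := is_derive_scale 1 (is_deriveV (f := fun y => 1 + expR (- y)) e0 D1).
move=> H; apply: (is_derive_val H); rewrite /sigmoid; set e := 1 + _ in e0 *.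
have -> : expR (- x) = e - 1 by rewrite /e addrC addKr.
by rewrite -exprVn /GRing.scale /=; field.
Qed.

(** Since S' = S (1 - S), differentiating a polynomial in S gives again a polynomial in S. *)
Lemma derive1n_sigmoid j : exists q : {poly R}, derive1n j S = fun x => q.[S x].
Proof.
elim: j => [|j [q IHj]]; first by exists 'X; apply/funext => x; rewrite hornerX.
exists (q^`() * ('X * (1 - 'X))); apply/funext => x.
rewrite derive1nS IHj derive1E.
have D := is_derive1_comp (g := S) (is_derive_poly q (S x)) (is_derive_sigmoid x).
by case: D => _ ->; rewrite !hornerE.
Qed.

Lemma Ck_sigmoid k : Ck k S.
Proof.
have D j (x : R) : derivable (derive1n j S) x 1.
  have [q ->] := derive1n_sigmoid j.
  by have [] := is_derive1_comp (g := S) (is_derive_poly q (S x)) (is_derive_sigmoid x).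
split=> [j _ x|x]; first exact: D.
by apply/differentiable_continuous/derivable1_diffP; exact: D.
Qed.

End Sigmoid.

Section Networks.
Variables (R : realType) (n : nat -> nat).
Local Notation Layers := (forall l : nat, 'I_(n l.+1) -> 'I_(n l) -> R -> R).

Lemma eq_KAnet (Phi Psi : Layers) L x :
  (forall l i j, (l < L)%N -> Phi l i j = Psi l i j) ->
  KAnet Phi L x = KAnet Psi L x.
Proof.
elim: L => [//|L IHL] E /=; rewrite IHL => [|l i j lL]; last exact/E/ltnW.
apply/matrixP => i j; rewrite !mxE; apply: eq_bigr => m _.
by rewrite (E L i m (leqnn _)).
Qed.

Lemma netclose_bounded2 N m p (F : 'I_m -> 'cV[R]_N -> R) H :
  (forall i, netclose p (F i) (H i)) -> exists2 M, 0 <= M &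
    (forall i x, cube x -> `|F i x| <= M) /\
    (forall i G x, (0 < G)%N -> cube x -> `|H i G x| <= M).
Proof.
move=> FH; have /choice[B HB] : forall i, exists B : R, [/\ 0 <= B,
    forall x, cube x -> `|F i x| <= B &
    forall G x, (0 < G)%N -> cube x -> `|H i G x| <= B].
  move=> i; have [KH KH0 HbH] := netclose_bounded (FH i).
  have [KF KF0 HbF] : rateO (@cube R N) (fun _ _ => 1) (fun _ => F i).
    by have := FH i; case: (p) => [|p'] [].
  exists (KF + KH); split; first exact: addr_ge0.
    by move=> x cx; have := HbF 1 x isT cx; rewrite mulr1 => /le_trans; apply; rewrite lerDl.
  by move=> G x G0 cx; have := HbH G x G0 cx; rewrite mulr1 => /le_trans; apply; rewrite lerDr.
have leB i : B i <= \sum_i B i.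
  by rewrite (bigD1 i)//= lerDl sumr_ge0// => m' _; case: (HB m').
exists (\sum_i B i); first by apply: sumr_ge0 => i _; case: (HB i).
split=> [i x cx|i G x G0 cx]; apply: le_trans (leB i); case: (HB i) => _ HF HH.
  exact: HF.
exact: HH.
Qed.

(* Layer l uses splines on [-(M l + 1), M l + 1], where M l bounds the inputs of
   that layer in the exact network and in all spline networks at once. *)
Definition spline_layers (k : nat) (Phi : Layers) (M : nat -> R) (G : nat) : Layers :=
  fun l i j => spline (- (M l + 1)) (M l + 1)
    (interp_coef (G := G) (k := k) (- (M l + 1)) (M l + 1) (Phi l i j)).

Lemma netclose_KAnet k (Phi : Layers) L :
    (forall l i j, (l < L)%N -> Ck k.+1 (Phi l i j)) ->
  exists2 M : nat -> R, (forall l, 0 <= M l) &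
    forall i, netclose k (fun x => KAnet Phi L x i 0)
      (fun G x => KAnet (spline_layers k Phi M G) L x i 0).
Proof.
elim: L => [|L IHL] PhiC.
  by exists (fun=> 0) => // i; exact: netclose_coord.
have [l i j lL|M M0 HM] := IHL; first exact/PhiC/ltnW.
have [B B0 [FB HB]] := netclose_bounded2 HM.
(* The interval of layer [L] is fixed only now, from bounds on the outputs of the layers below,
   which this change of [M] leaves as they were. *)
pose M' l := if l == L then B else M l.
have M'L : M' L = B by rewrite /M' eqxx.
exists M' => [l|i]; first by rewrite /M'; case: ifP.
have E G x : KAnet (spline_layers k Phi M' G) L x = KAnet (spline_layers k Phi M G) L x.
  by apply: eq_KAnet => l i' j lL; rewrite /spline_layers /M' ltn_eqF.
rewrite (_ : (fun x => _) = fun x => \sum_(j < n L) Phi L i j (KAnet Phi L x j 0)); last first.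
  by apply/funext => x; rewrite /= mxE.
rewrite (_ : (fun G x => _) = fun G x => \sum_(j < n L)
    dinterp k G (- (B + 1)) (B + 1) (Phi L i j) 0
      (KAnet (spline_layers k Phi M G) L x j 0)); last first.
  apply/funext => G; apply/funext => x; rewrite /= mxE; apply: eq_bigr => j _.
  by rewrite E /spline_layers M'L.
apply: netclose_sum => j.
have fC := PhiC L i j (leqnn _).
exact: (netclose_comp fC (netclose1_dinterp B0 fC) (HM j) (FB j) (HB j)).
Qed.

End Networks.

Theorem theorem1 (R : realType) (k L : nat) (hL : (1 <= L)%N)
  (n : nat -> nat) (hn : forall l : nat, (l <= L)%N -> (0 < n l)%N)
  (hnL : n L = 1%N)
  (V : 'cV[R]_(n 0%N) -> R)
  (hV01 : forall x, cube x -> 0 <= V x <= 1)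
  (Phi : forall l : nat, 'I_(n l.+1) -> 'I_(n l) -> R -> R)
  (hPhi : forall l i j, (l < L)%N -> Ck k.+1 (Phi l i j))
  (hV : forall x, cube x ->
     V x = sigmoid (KAnet Phi L x (cast_ord (esym hnL) ord0) 0)) :
  exists a b : forall l : nat, 'I_(n l.+1) -> 'I_(n l) -> R,
    (forall l i j, (l < L)%N -> a l i j < b l i j) /\
    exists C : R, forall G : nat, (1 <= G)%N ->
      exists Theta : forall l : nat,
          'I_(n l.+1) -> 'I_(n l) -> 'I_(G + k) -> R,
        let PhiG := fun l i j =>
          spline (a l i j) (b l i j) (Theta l i j) in
        let VTheta := fun x =>
          sigmoid (KAnet PhiG L x (cast_ord (esym hnL) ord0) 0) in
        forall m : nat, (m <= k)%N ->
          (Cnorm k m (fun x => (V x - VTheta x)%R) <=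
             (C * G%:R ^ (- k%:Z - 1 + m%:Z))%R%:E)%E.
Proof.
have [M M0 HM] := netclose_KAnet hPhi.
have [B B0 [FB HB]] := netclose_bounded2 HM.
set o := cast_ord _ _ in hV *.
have SC := netclose_comp (Ck_sigmoid R k.+1) (netclose1_refl B (Ck_sigmoid R k))
  (HM o) (FB o) (HB o).
have [C HC] := netclose_Cnorm SC hV.
(* All activation functions of a layer share one interval, chosen before the grid size. *)
exists (fun l _ _ => - (M l + 1)), (fun l _ _ => M l + 1); split.
  by move=> l _ _ _; have := M0 l; lra.
exists C => G G0.
exists (fun l i j => interp_coef (G := G) (k := k) (- (M l + 1)) (M l + 1) (Phi l i j)).
by move=> PhiG VTheta m mk; exact: HC.
Qed.
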